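(* Let $p,q\in\mathbb{D}=\{z\in\mathbb{C}:|z|<1\}$. Then there exists a unique conic $\mathcal{C}$ with foci $p,q$ which is $3$-Poncelet inscribed in the unit circle $\mathbb{T}=\{z\in\mathbb{C}:|z|=1\}$. Moreover, $\mathcal{C}$ is an ellipse, namely the Blaschke ellipse with major axis of length $|1-\bar p q|$, i.e. $\{w\in\mathbb{C}:\ |w-p|+|w-q|=|1-\bar p q|\}$.
   Context: The plane is identified with $\mathbb{C}$. A conic with foci $p,q$ means a non-degenerate ellipse or hyperbola with foci $p$ and $q$ (a circle centred at $p$ if $p=q$). A conic $\mathcal{C}$ is $3$-Poncelet inscribed in $\mathbb{T}$ if there is a triangle inscribed in $\mathbb{T}$ (vertices on $\mathbb{T}$) and circumscribed about $\mathcal{C}$ (the lines containing the sides are tangent to $\mathcal{C}$; the points of tangency need not lie on the sides, and $\mathcal{C}$ need not lie inside $\mathbb{T}$). As usual for Poncelet's theorem this is understood in the complexified projective plane: consecutive vertices are the two intersections of a side with $\mathbb{T}$, and consecutive sides are the two tangents from a vertex to $\mathcal{C}$, both counted with multiplicity; the trivial polygon sitting at a point of tangency of the two conics is not counted. The Blaschke ellipse with foci $p,q$ (degree 3) is the ellipse tangent, for every $\lambda\in\mathbb{T}$, to the lines joining the three distinct solutions of $B(z)=\lambda$, where $B(z)=z\,\frac{p-z}{1-\bar p z}\,\frac{q-z}{1-\bar q z}$ is the Blaschke product with zeros $0,p,q$; it is given by $|w-p|+|w-q|=|1-\bar pq|$. *)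

(* Defs.v *)
From HB Require Import structures.
From mathcomp Require Import all_boot all_order all_algebra.
From mathcomp Require Import mathcomp_extra boolp classical_sets reals complex.

Set Implicit Arguments.
Unset Strict Implicit.
Unset Printing Implicit Defensive.

Import Order.TTheory GRing.Theory Num.Theory.

Local Open Scope classical_set_scope.
Local Open Scope ring_scope.

(* On R[i] the norm is R[i]-valued and x < y implies that y - x is real. *)

(* Here d is the length of the major axis, so p = q gives the circle centred
   at p with diameter d. *)
Definition ellipse (R : realType) (p q d : R[i]) : set R[i] :=
  [set w | `|w - p| + `|w - q| = d].

Definition hyperbola (R : realType) (p q d : R[i]) : set R[i] :=
  [set w | `| `|w - p| - `|w - q| | = d].

Definition ellipse_with_foci (R : realType) (p q : R[i]) (C : set R[i]) : Prop :=
  exists2 d : R[i], `|p - q| < d & C = ellipse p q d.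

Definition hyperbola_with_foci (R : realType) (p q : R[i]) (C : set R[i]) : Prop :=
  exists2 d : R[i], 0 < d < `|p - q| & C = hyperbola p q d.

Definition conic_with_foci (R : realType) (p q : R[i]) (C : set R[i]) : Prop :=
  ellipse_with_foci p q C \/ hyperbola_with_foci p q C.

(* The complex projective plane: a point is represented by a nonzero row vector
   x, a line by a nonzero row vector l (the line x *m l^T = 0), equality of
   points or of lines is equality of row spaces, and a conic is represented by
   a symmetric matrix A (the conic x *m A *m x^T = 0). *)

(* x + i y |-> (x : y : 1) *)
Definition plane_point (R : realType) (w : R[i]) : 'rV[R[i]]_3 :=
  \row_i [:: (complex.Re w)%:C%C; (complex.Im w)%:C%C; 1]`_i.

Definition on_line (R : realType) (l x : 'rV[R[i]]_3) : Prop := x *m l^T = 0.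

Definition on_conic (R : realType) (A : 'M[R[i]]_3) (x : 'rV[R[i]]_3) : Prop :=
  x *m A *m x^T = 0.

Definition complexify (R : realType) (A : 'M[R]_3) : 'M[R[i]]_3 :=
  map_mx (real_complex R) A.

Definition conic_equation (R : realType) (A : 'M[R]_3) (C : set R[i]) : Prop :=
  [/\ A^T = A, \det A != 0 &
      C = [set w | on_conic (complexify A) (plane_point w)]].

Definition tangent_at (R : realType) (A : 'M[R[i]]_3) (x l : 'rV[R[i]]_3) : Prop :=
  on_conic A x /\ (l == x *m A)%MS.

Definition tangent (R : realType) (A : 'M[R[i]]_3) (l : 'rV[R[i]]_3) : Prop :=
  exists2 x : 'rV[R[i]]_3, x != 0 & tangent_at A x l.

(* x and y are the two intersections of l with the conic A, counted with
   multiplicity. *)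
Definition intersections (R : realType) (A : 'M[R[i]]_3)
    (l x y : 'rV[R[i]]_3) : Prop :=
  [/\ on_conic A x /\ on_line l x, on_conic A y /\ on_line l y &
      (x == y)%MS -> tangent_at A x l].

(* l and m are the two tangents from x to the conic A, counted with
   multiplicity; they coincide exactly when x lies on A. *)
Definition tangents_from (R : realType) (A : 'M[R[i]]_3)
    (x l m : 'rV[R[i]]_3) : Prop :=
  [/\ tangent A l /\ on_line l x, tangent A m /\ on_line m x &
      (l == m)%MS -> tangent_at A x l].

(* The vertices are v 0, v 1, v 2 and the side l i joins v i to v (i + 1), with
   indices modulo 3. *)
Definition poncelet_triangle (R : realType) (K A : 'M[R[i]]_3)
    (v l : 'I_3 -> 'rV[R[i]]_3) : Prop :=
  forall i : 'I_3,
    [/\ v i != 0, l i != 0,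
        intersections K (l i) (v i) (v (ordS i)) &
        tangents_from A (v (ordS i)) (l i) (l (ordS i))].

Definition trivial_polygon (R : realType) (K A : 'M[R[i]]_3)
    (v l : 'I_3 -> 'rV[R[i]]_3) : Prop :=
  exists x t : 'rV[R[i]]_3,
    [/\ tangent_at K x t, tangent_at A x t &
        forall i, (v i == x)%MS /\ (l i == t)%MS].

Definition unit_circle_mx (R : realType) : 'M[R]_3 :=
  diag_mx (\row_i [:: 1; 1; -1]`_i).

Lemma unit_circle_equation (R : realType) :
  conic_equation (unit_circle_mx R) [set w : R[i] | `|w| = 1].
Proof.
split; first exact: tr_diag_mx.
  by rewrite det_diag !big_ord_recl big_ord0 !mxE /= mulr1 !mul1r oppr_eq0 oner_eq0.
rewrite predeqE => -[x y]; rewrite /on_conic /complexify /=.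
have -> : plane_point (x +i* y)%C *m map_mx (real_complex R) (unit_circle_mx R) *m
    (plane_point (x +i* y)%C)^T = ((x ^+ 2 + y ^+ 2 - 1)%:C%C)%:M.
  apply/rowP => j; rewrite !ord1 !mxE !big_ord_recl big_ord0.
  rewrite !mxE !big_ord_recl !big_ord0 !mxE /=.
  rewrite !mulr0n !mulr1n !rmorph0 !rmorphD !rmorphN !rmorph1 !rmorphXn /=.
  by rewrite !mulr0 !addr0 !add0r !mulr1 mul1r !addrA -!expr2.
have -> : (`|(x +i* y)%C| = 1) = (x ^+ 2 + y ^+ 2 - 1 = 0).
  rewrite propeqE normc_def /=.
  have -> : (1 : R[i]) = (1 : R)%:C%C by [].
  have ge0 : 0 <= x ^+ 2 + y ^+ 2 by rewrite addr_ge0 ?sqr_ge0.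
  split=> [/complexI /(congr1 (fun z => z ^+ 2))|/eqP].
    by rewrite sqr_sqrtr // expr1n => ->; rewrite subrr.
  by rewrite subr_eq0 => /eqP ->; rewrite sqrtr1.
split=> [->|/matrixP/(_ 0 0)]; first by apply/rowP => j; rewrite !mxE mul0rn.
by rewrite !mxE /= mulr1n => /complexI.
Qed.

Definition poncelet3_inscribed (R : realType) (C : set R[i]) : Prop :=
  exists2 A : 'M[R]_3, conic_equation A C &
    exists v l : 'I_3 -> 'rV[R[i]]_3,
      poncelet_triangle (complexify (unit_circle_mx R)) (complexify A) v l /\
      ~ trivial_polygon (complexify (unit_circle_mx R)) (complexify A) v l.

Definition blaschke (R : realType) (p q z : R[i]) : R[i] :=
  z * ((p - z) / (1 - p^* * z)) * ((q - z) / (1 - q^* * z)).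

Definition blaschke_ellipse (R : realType) (p q : R[i]) (C : set R[i]) : Prop :=
  ellipse_with_foci p q C /\
  exists2 A : 'M[R]_3, conic_equation A C &
    forall lambda z1 z2 : R[i], `|lambda| = 1 ->
      blaschke p q z1 = lambda -> blaschke p q z2 = lambda -> z1 != z2 ->
      forall l : 'rV[R[i]]_3, l != 0 ->
        on_line l (plane_point z1) -> on_line l (plane_point z2) ->
        tangent (complexify A) l.

(* Main.v *)
Require Import Defs.
From HB Require Import structures.
From mathcomp Require Import all_boot all_order all_algebra.
From mathcomp Require Import mathcomp_extra boolp classical_sets reals complex.
From mathcomp Require Import ring lra.

Set Implicit Arguments.
Unset Strict Implicit.
Unset Printing Implicit Defensive.

Import Order.TTheory GRing.Theory Num.Theory.

Local Open Scope classical_set_scope.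
Local Open Scope ring_scope.

(** Parametrise the complexified circle by z = s/r in the projective line. A
    conic with foci p, q and major axis sqrt t is, dually, the set of lines with
    4 (l.p) (l.q) = k (l_1^2 + l_2^2), where k = t - |p - q|^2 (negative for a
    hyperbola). The chord with end parameters z, w is therefore tangent to it iff
      (p + p^* z w - z - w) (q + q^* z w - z - w) = k z w.
    Read as a quadratic equation in w, its roots are the two neighbours of z, so
    their product is (p - z) (q - z) / ((1 - p^* z) (1 - q^* z)) whatever k is:
    the vertices of a Poncelet triangle share the Blaschke value L = z1 z2 z3.
    Hence they are the roots of the cubic B(z) = L, whose root sum, compared with
    the sum of the two neighbours, forces k = (1 - |p|^2) (1 - |q|^2), that is,
    t = |1 - p^* q|^2. Conversely for this k the triangle starting at z = 1
    closes up, and 1 is neither on the ellipse nor is its tangent to the circle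
    tangent to the ellipse, so the three vertices are distinct. *)

(** * The tangency correspondence *)

(** Certificate form of an equational proof: the coefficient is supplied by hand, and the remaining
    identity is left to [ring] or [field]. *)
Lemma eq_lincomb1 {F : pzRingType} {x y a b : F} (c : F) :
  x = y -> a - b = c * (x - y) -> a = b.
Proof. by move=> ->; rewrite subrr mulr0 => /subr0_eq. Qed.

Lemma eq_lincomb2 {F : pzRingType} {x y x' y' a b : F} (c c' : F) :
  x = y -> x' = y' -> a - b = c * (x - y) + c' * (x' - y') -> a = b.
Proof. by move=> -> ->; rewrite !subrr !mulr0 addr0 => /subr0_eq. Qed.

Arguments eq_lincomb1 {F x y a b} c.
Arguments eq_lincomb2 {F x y x' y' a b} c c'.

Section Correspondence.
Context {F : fieldType}.
Implicit Types (p q k : F) (z w : F * F).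

(* A parameter (s, r) stands for s/r, and p', q' for the conjugates of p, q. For
   fixed z the condition that the chord from z to w is tangent reads
   lead w^2 - mid w + const = 0; [side_polar] is twice the polar form. *)
Definition side_lead p' q' z := (z.2 - p' * z.1) * (z.2 - q' * z.1).

Definition side_mid p p' q q' k z :=
  (p * z.2 - z.1) * (z.2 - q' * z.1) + (q * z.2 - z.1) * (z.2 - p' * z.1)
  + k * (z.1 * z.2).

Definition side_const p q z := (p * z.2 - z.1) * (q * z.2 - z.1).

Definition side_polar p p' q q' k z w1 w2 :=
  2 * side_lead p' q' z * (w1.1 * w2.1)
  - side_mid p p' q q' k z * (w1.1 * w2.2 + w2.1 * w1.2)
  + 2 * side_const p q z * (w1.2 * w2.2).

(* The quadratic form at z has the roots w1, w2, with multiplicity. *)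
Definition vieta p p' q q' k z w1 w2 : Prop :=
  [/\ side_lead p' q' z * (w1.1 * w2.1) = side_const p q z * (w1.2 * w2.2),
      side_lead p' q' z * (w1.1 * w2.2 + w2.1 * w1.2)
        = side_mid p p' q q' k z * (w1.2 * w2.2) &
      side_const p q z * (w1.1 * w2.2 + w2.1 * w1.2)
        = side_mid p p' q q' k z * (w1.1 * w2.1)].

Definition same_param z w : Prop := z.1 * w.2 = w.1 * z.2.

Definition nonzero_param z : Prop := z.1 != 0 \/ z.2 != 0.

Definition closed_triple p p' q q' k z1 z2 z3 : Prop :=
  [/\ vieta p p' q q' k z1 z2 z3, vieta p p' q q' k z2 z3 z1 &
      vieta p p' q q' k z3 z1 z2].

Definition swap_param z : F * F := (z.2, z.1).

(** The inversion z -> 1/z exchanges the foci with their conjugates, so a vertex at infinity can be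
    treated as a vertex at 0. *)
Lemma vieta_swap p p' q q' k z w1 w2 : vieta p p' q q' k z w1 w2 ->
  vieta p' p q' q k (swap_param z) (swap_param w1) (swap_param w2).
Proof.
rewrite /vieta /side_lead /side_mid /side_const /= => -[e1 e2 e3]; split.
- by apply: (eq_lincomb1 (-1) e1); ring.
- by apply: (eq_lincomb1 1 e3); ring.
- by apply: (eq_lincomb1 1 e2); ring.
Qed.

Lemma closed_triple_swap p p' q q' k z1 z2 z3 :
  closed_triple p p' q q' k z1 z2 z3 ->
  closed_triple p' p q' q k (swap_param z1) (swap_param z2) (swap_param z3).
Proof. by case=> ? ? ?; split; apply: vieta_swap. Qed.

Lemma closed_triple_rot p p' q q' k z1 z2 z3 :
  closed_triple p p' q q' k z1 z2 z3 -> closed_triple p p' q q' k z2 z3 z1.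
Proof. by case. Qed.

(** Two distinct projective roots determine a binary quadratic form up to scale. The determinant
    [s * r' - s' * r] of the roots is the factor cancelled in each relation. *)
Lemma side_vieta p p' q q' k z w1 w2 : 2 != 0 :> F -> ~ same_param w1 w2 ->
  side_polar p p' q q' k z w1 w1 = 0 -> side_polar p p' q q' k z w2 w2 = 0 ->
  vieta p p' q q' k z w1 w2.
Proof.
rewrite /same_param /side_polar /vieta.
move: (side_lead _ _ _) (side_mid _ _ _ _ _ _) (side_const _ _ _) => a b c.
case: w1 w2 => [s r] [s' r'] /= nz2 neq e1 e2.
have nz : 2 * (s * r' - s' * r) != 0.
  by rewrite mulf_neq0 // subr_eq0; apply/eqP.
split; apply: (mulfI nz).
- by apply: (eq_lincomb2 (s' * r') (- (s * r)) e1 e2); ring.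
- by apply: (eq_lincomb2 (r' ^+ 2) (- r ^+ 2) e1 e2); ring.
- by apply: (eq_lincomb2 (- s' ^+ 2) (s ^+ 2) e1 e2); ring.
Qed.

(** A double root is a vector in the kernel of the polar form; testing the kernel against [(1, 0)]
    and [(0, 1)] gives the two linear relations used. *)
Lemma side_vieta_double p p' q q' k z w1 w2 : 2 != 0 :> F ->
  same_param w1 w2 -> nonzero_param w1 -> nonzero_param w2 ->
  (forall w, side_polar p p' q q' k z w w1 = 0) ->
  vieta p p' q q' k z w1 w2.
Proof.
rewrite /side_polar /vieta => nz2 same n1 n2.
move: (side_lead _ _ _) (side_mid _ _ _ _ _ _) (side_const _ _ _) => a b c.
case: w1 w2 same n1 n2 => [s r] [s' r']; rewrite /same_param /nonzero_param /=.
move=> same n1 n2 h; move: (h (1, 0)) (h (0, 1)) => /=.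
rewrite !(mul1r, mul0r, mulr0, addr0, add0r, mulr1, subr0, sub0r) => e1 e2.
have [c' [-> ->]] : exists c', s' = c' * s /\ r' = c' * r.
  case: n1 => nz; [exists (s' / s) | exists (r' / r)]; rewrite divfK //; split=> //.
    by apply: (mulIf nz); rewrite mulrAC divfK // mulrC.
  by apply: (mulIf nz); rewrite mulrAC divfK // -same mulrC.
split; apply: (mulfI nz2).
- by apply: (eq_lincomb2 (c' * s) (- c' * r) e1 e2); ring.
- by apply: (eq_lincomb1 (2 * c' * r) e1); ring.
- by apply: (eq_lincomb1 (2 * c' * s) e2); ring.
Qed.

(* From the parameter 0 the other two vertices have parameters p and q. *)
Lemma closed_triple_zero p p' q q' k z1 z2 z3 :
  z1.1 = 0 -> nonzero_param z1 -> nonzero_param z2 -> nonzero_param z3 ->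
  ~ (same_param z1 z2 /\ same_param z2 z3) ->
  closed_triple p p' q q' k z1 z2 z3 -> k = (1 - p * p') * (1 - q * q').
Proof.
case: z1 z2 z3 => [s1 r1] [s2 r2] [s3 r3]; rewrite /nonzero_param /same_param /=.
move=> ->; rewrite eqxx => -[//|nr1] n2 n3.
rewrite /closed_triple /vieta /side_lead /side_mid /side_const /=.
rewrite !(mul0r, mulr0, subr0, addr0, add0r).
move=> neq [[h1 h2 _] [_ h2' _] [_ h3' _]].
have nr11 : r1 * r1 != 0 by rewrite mulf_neq0.
have {}h1 : s2 * s3 = p * q * (r2 * r3) by apply: (mulfI nr11); rewrite h1; ring.
have {}h2 : s2 * r3 + s3 * r2 = (p + q) * (r2 * r3).
  by apply: (mulfI nr11); rewrite h2; ring.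
have nr2 : r2 != 0.
  apply/eqP => r20; move: h1 h2; rewrite r20 !(mul0r, mulr0, addr0).
  move=> /eqP; rewrite mulf_eq0 => /orP[] /eqP s0.
    by case: n2; rewrite ?s0 ?r20 eqxx.
  move=> /eqP; rewrite mulf_eq0 => /orP[] /eqP r0.
    by case: n2; rewrite ?r0 ?r20 eqxx.
  by case: n3; rewrite ?r0 ?s0 eqxx.
have nr3 : r3 != 0.
  apply/eqP => r30; move: h1 h2; rewrite r30 !(mul0r, mulr0, addr0, add0r).
  move=> /eqP; rewrite mulf_eq0 => /orP[] /eqP s0; last first.
    by case: n3; rewrite ?s0 ?r30 eqxx.
  by move=> /eqP; rewrite mulf_eq0 (negbTE nr2) orbF => /eqP r0; case: n3; rewrite ?r30 ?r0 eqxx.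
have [a ea] : exists a, s2 = a * r2 by exists (s2 / r2); rewrite divfK.
have [b eb] : exists b, s3 = b * r3 by exists (s3 / r3); rewrite divfK.
subst s2 s3.
have nr23 : r2 * r3 != 0 by rewrite mulf_neq0.
have {}h1 : a * b = p * q by apply: (mulIf nr23); rewrite -h1; ring.
have {}h2 : a + b = p + q by apply: (mulIf nr23); rewrite -h2; ring.
have n2' : r1 * r2 ^+ 2 * r3 != 0 by rewrite !mulf_neq0 ?expf_neq0.
have n3' : r1 * r3 ^+ 2 * r2 != 0 by rewrite !mulf_neq0 ?expf_neq0.
set k0 := _ * _.
(* Sum and product show that [a], [b] are [p], [q] in some order. The equations at the two other
   vertices then give [k], up to the factors [a] and [b]; these do not both vanish, since otherwise
   all three vertices would sit at 0. *)
have [ha hb] : a * k = a * k0 /\ b * k = b * k0.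
  have eb : b = p + q - a by rewrite -h2 addrC addKr.
  have ea : (a - p) * (a - q) = 0.
    by apply: (eq_lincomb2 a (-1) h2 h1); ring.
  have : a = p \/ a = q.
    move/eqP: ea; rewrite mulf_eq0 !subr_eq0 => /orP[] /eqP; by [left|right].
  case=> ea'; subst a.
  - have {}eb : b = q by rewrite eb addrC addKr.
    subst b; split; rewrite /k0.
      by apply: (mulfI n2'); apply: (eq_lincomb1 (-1) h2'); ring.
    by apply: (mulfI n3'); apply: (eq_lincomb1 (-1) h3'); ring.
  - have {}eb : b = p by rewrite eb addrK.
    subst b; split; rewrite /k0.
      by apply: (mulfI n2'); apply: (eq_lincomb1 (-1) h2'); ring.
    by apply: (mulfI n3'); apply: (eq_lincomb1 (-1) h3'); ring.
have [a0|na] := eqVneq a 0; last exact: (mulfI na).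
have [b0|nb] := eqVneq b 0; last exact: (mulfI nb).
by case: neq; rewrite a0 b0 !mul0r.
Qed.

(** One representative for each point of the projective line, so that [same_param] between such
    representatives becomes equality. *)
Definition normal_param z : Prop := z.2 = 1 \/ z = (1, 0).

Lemma normal_param_nonzero z : normal_param z -> nonzero_param z.
Proof.
by case: z => s r; rewrite /nonzero_param => -[/= ->|->] /=; rewrite oner_neq0;
  [right|left].
Qed.

(* With L the product of the parameters, each of them is a root of
   z (p - z) (q - z) = L (1 - p' z) (1 - q' z); subtracting two of these
   equations gives the sum of the parameters. *)
Lemma closed_triple_affine p p' q q' k (a b c : F) :
  a != 0 -> b != 0 -> a != b ->
  closed_triple p p' q q' k (a, 1) (b, 1) (c, 1) ->
  k = (1 - p * p') * (1 - q * q').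
Proof.
move=> na nb; rewrite -subr_eq0 => nab.
rewrite /closed_triple /vieta /side_lead /side_mid /side_const /= !mulr1.
move=> -[[ha1 ha2 _] [hb1 _ _] _].
have sum : a + b + c = p + q + a * b * c * (p' * q').
  have nz : a * b * (a - b) != 0 by rewrite !mulf_neq0.
  by apply: (mulfI nz); apply: (eq_lincomb2 (- a * b) (a * b) ha1 hb1); ring.
apply: (mulfI na); move: ha2.
have -> : b + c = p + q + a * b * c * (p' * q') - a by rewrite -sum; ring.
move=> ha2.
by apply: (eq_lincomb2 (-1) (a * (p' * q')) ha2 ha1); ring.
Qed.

(** After rotating the triple, either some parameter is 0, or one is infinite and the swap brings it
    to 0, or all are finite and nonzero. In the last case two consecutive ones differ and the affine
    computation applies. *)
Lemma closed_triple_invariant p p' q q' k z1 z2 z3 :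
  normal_param z1 -> normal_param z2 -> normal_param z3 ->
  ~ (same_param z1 z2 /\ same_param z2 z3) ->
  closed_triple p p' q q' k z1 z2 z3 -> k = (1 - p * p') * (1 - q * q').
Proof.
move=> n1 n2 n3 neq h.
have nz1 := normal_param_nonzero n1; have nz2 := normal_param_nonzero n2.
have nz3 := normal_param_nonzero n3.
have same_trans (x y z : F * F) : nonzero_param y -> same_param x y ->
    same_param y z -> same_param x z.
  case: x y z => [x1 x2] [y1 y2] [u1 u2].
  rewrite /nonzero_param /same_param /= => -[] ny e1 e2; apply: (mulfI ny).
    by apply: (eq_lincomb2 u1 x1 e1 e2); ring.
  by apply: (eq_lincomb2 u2 x2 e1 e2); ring.
have zero w1 w2 w3 : nonzero_param w1 -> nonzero_param w2 -> nonzero_param w3 ->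
    ~ (same_param w1 w2 /\ same_param w2 w3) ->
    closed_triple p p' q q' k w1 w2 w3 -> w1.1 = 0 \/ w1.2 = 0 ->
    k = (1 - p * p') * (1 - q * q').
  move=> m1 m2 m3 nw hw [w0|w0]; first exact: (closed_triple_zero w0 m1 m2 m3 nw hw).
  rewrite (mulrC p) (mulrC q).
  apply: (@closed_triple_zero p' p q' q k (swap_param w1) (swap_param w2)
    (swap_param w3)) => //.
  - by case: m1; [right|left].
  - by case: m2; [right|left].
  - by case: m3; [right|left].
  - move=> [e1 e2]; apply: nw; split; rewrite /same_param /swap_param /= in e1 e2 *.
      by rewrite mulrC -e1 mulrC.
    by rewrite mulrC -e2 mulrC.
  - exact: closed_triple_swap.
have neq2 : ~ (same_param z2 z3 /\ same_param z3 z1).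
  move=> [e1 e2]; apply: neq; split=> //.
  by apply/esym; exact: (same_trans z2 z3 z1).
have neq3 : ~ (same_param z3 z1 /\ same_param z1 z2).
  move=> [e1 e2]; apply: neq; split=> //.
  by apply/esym; exact: (same_trans z3 z1 z2).
have h2 := closed_triple_rot h; have h3 := closed_triple_rot h2.
case: n1 => [r1|z10]; last by apply: (zero z1 z2 z3) => //; right; rewrite z10.
case: n2 => [r2|z20]; last by apply: (zero z2 z3 z1) => //; right; rewrite z20.
case: n3 => [r3|z30]; last by apply: (zero z3 z1 z2) => //; right; rewrite z30.
have [s1|s1] := eqVneq z1.1 0; first by apply: (zero z1 z2 z3) => //; left.
have [s2|s2] := eqVneq z2.1 0; first by apply: (zero z2 z3 z1) => //; left.
have [s3|s3] := eqVneq z3.1 0; first by apply: (zero z3 z1 z2) => //; left.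
have [e12|e12] := eqVneq z1.1 z2.1; last first.
  apply: (closed_triple_affine s1 s2 e12 (c := z3.1)).
  by rewrite -{1}r1 -{1}r2 -r3 -!surjective_pairing.
have [e23|e23] := eqVneq z2.1 z3.1; last first.
  apply: (closed_triple_affine s2 s3 e23 (c := z1.1)).
  by rewrite -{1}r2 -{1}r3 -r1 -!surjective_pairing.
by case: neq; rewrite /same_param r1 r2 r3 e12 e23.
Qed.

(** Here [a] and [b] are two roots of the cubic B(z) = L. The product of its roots is L, so [c] with
    L = a b c stands for the third root, and its root sum gives the middle coefficient of the
    quadratic at [a]. *)
Lemma blaschke_side p p' q q' (L a b : F) : a != 0 -> b != 0 -> a != b ->
  a * side_const p q (a, 1) = L * side_lead p' q' (a, 1) ->
  b * side_const p q (b, 1) = L * side_lead p' q' (b, 1) ->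
  side_polar p p' q q' ((1 - p * p') * (1 - q * q')) (a, 1) (b, 1) (b, 1) = 0.
Proof.
move=> na nb nab.
have [c ->] : exists c, L = a * b * c.
  by exists (L / (a * b)); rewrite mulrC divfK // mulf_neq0.
rewrite /side_polar /side_mid /side_const /side_lead /= !mulr1 => ha hb.
have nab' : a - b != 0 by rewrite subr_eq0.
have sum : a + b + c = p + q + a * b * c * (p' * q').
  by apply: (mulfI nab'); apply: (mulfI na); apply: (mulfI nb);
    apply: (eq_lincomb2 b (- a) ha hb); ring.
have mid : (1 - p' * a) * (1 - q' * a) * (b + c) =
    (p - a) * (1 - q' * a) + (q - a) * (1 - p' * a)
    + (1 - p * p') * (1 - q * q') * a.
  have -> : b + c = p + q + a * b * c * (p' * q') - a by rewrite -sum; ring.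
  by apply: (eq_lincomb1 (- (p' * q')) ha); ring.
by apply: (mulfI na); apply: (eq_lincomb2 (2 * (a * b)) 2 mid ha); ring.
Qed.

(* The opposite side closes up because b and c are roots of the cubic
   z (p - z) (q - z) = a b c (1 - p' z) (1 - q' z). *)
Lemma poncelet_closure p p' q q' (a b c : F) :
  let k := (1 - p * p') * (1 - q * q') in
  a != 0 -> b != 0 -> side_lead p' q' (a, 1) != 0 ->
  side_lead p' q' (a, 1) * (b * c) = side_const p q (a, 1) ->
  side_lead p' q' (a, 1) * (b + c) = side_mid p p' q q' k (a, 1) ->
  side_polar p p' q q' k (b, 1) (c, 1) (c, 1) = 0.
Proof.
rewrite /side_polar /side_mid /side_const /side_lead /= !mulr1.
move=> na nb nl hc hm.
have sum : a + b + c = p + q + a * b * c * (p' * q').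
  by apply: (mulfI nl); apply: (eq_lincomb2 1 (- (a * (p' * q'))) hm hc); ring.
have sum2 : a * b + b * c + c * a = p * q + a * b * c * (p' + q').
  apply: (mulfI na).
  by apply: (eq_lincomb2 (a ^+ 2) a sum hc); ring.
have hb : b * ((p - b) * (q - b)) = a * b * c * ((1 - p' * b) * (1 - q' * b)).
  by apply: (eq_lincomb2 (b ^+ 2) (- b) sum sum2); ring.
have mid : (1 - p' * b) * (1 - q' * b) * (a + c) =
    (p - b) * (1 - q' * b) + (q - b) * (1 - p' * b)
    + (1 - p * p') * (1 - q * q') * b.
  have -> : a + c = p + q + a * b * c * (p' * q') - b by rewrite -sum; ring.
  by apply: (eq_lincomb1 (- (p' * q')) hb); ring.
by apply: (mulfI nb); apply: (eq_lincomb2 (2 * (b * c)) 2 mid hb); ring.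
Qed.

End Correspondence.

(** * Coordinates and duality *)

Section Coordinates.
Context {K : comNzRingType}.
Implicit Types (a b c d e f : K).

Definition row3 a b c : 'rV[K]_3 := \row_j [:: a; b; c]`_j.

Definition sym3 a b c d e f : 'M[K]_3 :=
  \matrix_(i, j) (nth [::] [:: [:: a; b; c]; [:: b; d; e]; [:: c; e; f]] i)`_j.

Lemma row3_eta (v : 'rV[K]_3) : v = row3 (v 0 0) (v 0 1) (v 0 (inord 2)).
Proof.
apply/rowP; case; case=> [|[|[|//]]] lt3; rewrite mxE /=; congr (v _ _);
  apply/val_inj => //=; by rewrite inordK.
Qed.

Lemma row3_inj a b c a' b' c' : row3 a b c = row3 a' b' c' ->
  [/\ a = a', b = b' & c = c'].
Proof.
move=> /rowP h; move: (h 0) (h 1) (h (inord 2)).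
by rewrite !mxE /= !inordK.
Qed.

Lemma row3_eq0 a b c : row3 a b c = 0 -> [/\ a = 0, b = 0 & c = 0].
Proof.
move=> /rowP h; move: (h 0) (h 1) (h (inord 2)).
by rewrite !mxE /= !inordK.
Qed.

Lemma scale_row3 x a b c : x *: row3 a b c = row3 (x * a) (x * b) (x * c).
Proof. by apply/rowP; case; case=> [|[|[|//]]] lt3; rewrite !mxE. Qed.

Lemma sym3_eta (A : 'M[K]_3) : A^T = A ->
  A = sym3 (A 0 0) (A 0 1) (A 0 (inord 2)) (A 1 1) (A 1 (inord 2))
        (A (inord 2) (inord 2)).
Proof.
move=> sA; have h i j : A i j = A j i by rewrite -{1}sA mxE.
have e2 : inord 2 = Ordinal (erefl (2 < 3)%N) :> 'I_3.
  by apply/val_inj; rewrite /= inordK.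
apply/matrixP; case; case=> [|[|[|//]]] lti; case; case=> [|[|[|//]]] ltj;
  rewrite mxE /= ?e2; solve [by congr (A _ _); apply/val_inj
  | by rewrite h; congr (A _ _); apply/val_inj].
Qed.

Lemma sym3_tr a b c d e f : (sym3 a b c d e f)^T = sym3 a b c d e f.
Proof.
by apply/matrixP; case; case=> [|[|[|//]]] lti; case; case=> [|[|[|//]]] ltj;
  rewrite !mxE.
Qed.

Lemma dot_row3 a b c a' b' c' :
  row3 a b c *m (row3 a' b' c')^T = (a * a' + b * b' + c * c')%:M.
Proof.
apply/rowP => j; rewrite !ord1 !mxE !big_ord_recl big_ord0 !mxE /= mulr1n.
by ring.
Qed.

Lemma row3_mul_sym3 x y z a b c d e f :
  row3 x y z *m sym3 a b c d e f =
  row3 (x * a + y * b + z * c) (x * b + y * d + z * e) (x * c + y * e + z * f).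
Proof.
apply/rowP; case; case=> [|[|[|//]]] lt3;
  rewrite !mxE !big_ord_recl big_ord0 !mxE /=; ring.
Qed.

Lemma scalar11_eq0 a : (a%:M = 0 :> 'M_1) <-> a = 0.
Proof.
by split=> [/matrixP/(_ 0 0)|->]; rewrite ?mxE ?mulr1n // raddf0.
Qed.

End Coordinates.

Lemma map_sym3 (K L : comNzRingType) (g : {rmorphism K -> L}) (a b c d e f : K) :
  map_mx g (sym3 a b c d e f) = sym3 (g a) (g b) (g c) (g d) (g e) (g f).
Proof.
by apply/matrixP; case; case=> [|[|[|//]]] lti; case; case=> [|[|[|//]]] ltj;
  rewrite !mxE.
Qed.

Section Tangents.
Context {R : realType}.
Local Notation C := R[i].
Implicit Types (A D : 'M[C]_3) (l x y : 'rV[C]_3).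

Lemma eqmx_rowP x y : x != 0 -> (x == y)%MS -> exists2 c, c != 0 & x = c *: y.
Proof.
move=> nx /andP[/sub_rVP[c ex] _]; exists c => //.
by apply: contraNneq nx => c0; rewrite ex c0 scale0r.
Qed.

Lemma tangent_at_scale A x l c : c != 0 -> tangent_at A (c *: x) l <-> tangent_at A x l.
Proof.
move=> nc; rewrite /tangent_at /on_conic linearZ /= -!scalemxAl -scalemxAr.
split=> -[ha hl]; split.
- move/eqP: ha; rewrite !scaler_eq0 (negbTE nc) /=; exact: eqP.
- by apply/eqmxP; apply: eqmx_trans (eqmxP hl) _; exact: eqmx_scale.
- by rewrite ha !scaler0.
- apply/eqmxP; apply: eqmx_trans (eqmxP hl) _; apply: eqmx_sym.
  exact: eqmx_scale.
Qed.

Section Dual.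
Context (A D : 'M[C]_3) (m : C).
Context (nm : m != 0) (sA : A^T = A) (sD : D^T = D) (AD : A *m D = m%:M).

Let DA : D *m A = m%:M.
Proof. by rewrite -[LHS]trmxK trmx_mul sA sD AD tr_scalar_mx. Qed.

(** The point of contact of a tangent line is its pole, which [D] computes because it inverts [A] up
    to scale. *)
Lemma tangent_at_dual x l : l != 0 -> tangent_at A x l ->
  exists2 c, c != 0 & l *m D = c *: x.
Proof.
move=> nl [_ /(eqmx_rowP nl)[c nc ->]]; exists (c * m); first exact: mulf_neq0.
by rewrite -scalemxAl -mulmxA AD mul_mx_scalar scalerA.
Qed.

(** The tangent lines of a nondegenerate conic form the dual conic, whose matrix is the inverse up
    to scale. Conversely, a zero [l] of the dual form touches the conic at its pole [l *m D]. *)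
Lemma tangent_dual l : l != 0 -> tangent A l <-> l *m D *m l^T = 0.
Proof.
move=> nl; split.
  case=> x nx tx; have [c nc ->] := tangent_at_dual nl tx.
  case: tx => ox /(eqmx_rowP nl)[c' _ ->].
  by rewrite -scalemxAl linearZ /= -scalemxAr trmx_mul sA mulmxA [x *m A *m _]ox !scaler0.
move=> h; have e : l *m D *m A = m *: l by rewrite -mulmxA DA mul_mx_scalar.
exists (l *m D).
  apply: contraNneq nl => l0; move: e; rewrite l0 mul0mx => /esym/eqP.
  by rewrite scaler_eq0 (negbTE nm).
split; rewrite ?/on_conic e; last by apply/eqmxP/eqmx_sym/eqmx_scale.
by rewrite trmx_mul sD -scalemxAl mulmxA h scaler0.
Qed.

End Dual.
End Tangents.

(** * The complexified unit circle *)

Section CircleParametrization.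
Context {R : realType}.
Local Notation C := R[i].
Local Notation K := (complexify (unit_circle_mx R)).
Implicit Types (z w : C * C) (l v x : 'rV[C]_3).

(* In the coordinates X = x + i y, Y = x - i y the circle is X Y = T^2, with
   points (s^2 : r^2 : s r); [circle_point] is twice that point. *)
Definition circle_point z : 'rV[C]_3 :=
  row3 (z.1 ^+ 2 + z.2 ^+ 2) (- 'i%C * (z.1 ^+ 2 - z.2 ^+ 2)) (2 * (z.1 * z.2)).

(** The join of the two circle points with the factor [z.2 * w.1 - z.1 * w.2] divided out; thus
    [z = w] gives the tangent line instead of 0. *)
Definition chord z w : 'rV[C]_3 :=
  row3 (z.2 * w.2 + z.1 * w.1) ('i%C * (z.2 * w.2 - z.1 * w.1))
    (- (z.1 * w.2 + w.1 * z.2)).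

(* The dual form l |-> 4 (l.p) (l.q) - k (l_1^2 + l_2^2). *)
Definition focal_dual {L : comNzRingType} (p1 p2 q1 q2 k : L) : 'M[L]_3 :=
  sym3 (4 * (p1 * q1) - k) (2 * (p1 * q2 + p2 * q1)) (2 * (p1 + q1))
    (4 * (p2 * q2) - k) (2 * (p2 + q2)) 4.

Lemma sqr_iC : 'i%C * 'i%C = -1 :> C.
Proof. by rewrite -expr2 sqr_i. Qed.

Lemma iC_neq0 : 'i%C != 0 :> C.
Proof. by rewrite eq_complex /= oner_eq0 andbF. Qed.

Lemma two_neq0 : 2 != 0 :> C.
Proof. by rewrite pnatr_eq0. Qed.

Lemma chordC z w : chord z w = chord w z.
Proof. by rewrite /chord; congr row3; ring. Qed.

Lemma complexify_unit_circle : K = sym3 1 0 0 1 0 (-1).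
Proof.
rewrite /complexify /unit_circle_mx.
apply/matrixP; case; case=> [|[|[|//]]] lti; case; case=> [|[|[|//]]] ltj;
  by rewrite !mxE /= ?mulr1n ?mulr0n ?rmorph0 ?rmorph1 ?rmorphN1.
Qed.

Lemma chord_circle_point z w : chord z w *m (circle_point z)^T = 0.
Proof.
by rewrite dot_row3; apply/scalar11_eq0; move: sqr_iC; set i := 'i%C => ii; ring: ii.
Qed.

Lemma circle_point_polar z : circle_point z *m K = chord z z.
Proof.
by rewrite complexify_unit_circle row3_mul_sym3; congr row3; ring.
Qed.

Lemma circle_point_on_circle z : on_conic K (circle_point z).
Proof. by rewrite /on_conic circle_point_polar chord_circle_point. Qed.

(** This is the bridge from geometry to the algebra above: for [w1 = w2] the dual form on a chord
    becomes the quadratic tangency condition. *)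
Lemma chord_dual p1 p2 q1 q2 k z w1 w2 :
  chord z w1 *m focal_dual p1 p2 q1 q2 k *m (chord z w2)^T =
  (2 * side_polar (p1 + 'i%C * p2) (p1 - 'i%C * p2) (q1 + 'i%C * q2)
         (q1 - 'i%C * q2) k z w1 w2)%:M.
Proof.
rewrite row3_mul_sym3 dot_row3; congr (_ %:M).
rewrite /side_polar /side_lead /side_mid /side_const.
by move: sqr_iC; set i := 'i%C => ii; ring: ii.
Qed.

Lemma circle_pointP v : v != 0 -> on_conic K v ->
  exists z, normal_param z /\ exists2 c, c != 0 & v = c *: circle_point z.
Proof.
rewrite [v]row3_eta; move: (v 0 0) (v 0 1) (v 0 (inord 2)) => x y t nv.
rewrite /on_conic complexify_unit_circle row3_mul_sym3 dot_row3 => /scalar11_eq0.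
move: sqr_iC iC_neq0 two_neq0; rewrite /circle_point; set i := 'i%C => ii ni n2 h.
have {}h : t ^+ 2 = (x + i * y) * (x - i * y).
  by apply: (eq_lincomb2 (-1) (y ^+ 2) h ii); ring.
(* On the curve X Y = T^2 the parameter is T / Y. If Y = 0 then T = 0 as well, and the point is the
   circular point at infinity with parameter [(1, 0)]. *)
have [Y0|nY] := eqVneq (x - i * y) 0.
  exists (1, 0); split; first by right.
  have t0 : t = 0.
    by move/eqP: h; rewrite Y0 mulr0 expf_eq0 => /= /eqP.
  exists ((x + i * y) / 2).
    apply: contraNneq nv => X0.
    have {}X0 : x + i * y = 0 by rewrite -[LHS](divfK n2) X0 mul0r.
    have x0 : x = 0.
      by apply: (mulfI n2); apply: (eq_lincomb2 1 1 X0 Y0); ring.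
    have y0 : y = 0.
      apply: (mulfI n2); apply: (mulfI ni).
      by apply: (eq_lincomb2 1 (-1) X0 Y0); ring.
    by rewrite x0 y0 t0; apply/eqP/rowP; case; case=> [|[|[|//]]] lt3; rewrite !mxE.
  rewrite scale_row3 /= t0; congr row3; rewrite ?expr0n ?expr1n /=.
  - by apply: (mulfI n2); apply: (eq_lincomb1 1 Y0); field.
  - apply: (mulfI n2); apply: (mulfI ni).
    by apply: (eq_lincomb2 (-1) ((x + i * y)) Y0 ii); field.
  - by rewrite !mulr0.
exists (t / (x - i * y), 1); split; first by left.
exists ((x - i * y) / 2); first by rewrite mulf_neq0 // invr_neq0.
have e : (t / (x - i * y)) ^+ 2 = (x + i * y) / (x - i * y).
  by rewrite expr_div_n h expr2 invfM mulrA mulfK.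
rewrite scale_row3 /= e; congr row3.
- by field; rewrite ?nY.
- apply: (mulfI ni); apply: (eq_lincomb1 (i * y) ii).
  by field; rewrite ?nY.
- by field; rewrite ?nY.
Qed.

Lemma same_param_normal z w : normal_param z -> normal_param w ->
  same_param z w -> z = w.
Proof.
case: z w => [s r] [s' r'] [/= ->|[-> ->]] [/= ->|[-> ->]]; rewrite /same_param /=.
- by rewrite !mulr1 => ->.
- by rewrite mulr0 mulr1 => /esym/eqP; rewrite oner_eq0.
- by rewrite mulr0 mulr1 => /eqP; rewrite oner_eq0.
- by [].
Qed.

(** Distinct points determine their line up to scale. When they coincide, the multiplicity clause
    makes [l] the polar of the point, which is the chord from [z] to itself. *)
Lemma intersections_chord l z w c c' : l != 0 -> c != 0 -> c' != 0 ->
  normal_param z -> normal_param w ->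
  intersections K l (c *: circle_point z) (c' *: circle_point w) ->
  exists2 e, e != 0 & l = e *: chord z w.
Proof.
move=> nl nc nc' nz nw [[_ hz] [_ hw] htan].
have [same|neq] := pselect (same_param z w).
  move: htan; rewrite -(same_param_normal nz nw same) => htan.
  have /(tangent_at_scale _ _ _ nc)[_] : tangent_at K (c *: circle_point z) l.
    have e1 := eqmx_scale (circle_point z) nc.
    have e2 := eqmx_scale (circle_point z) nc'.
    by apply: htan; apply/eqmxP; exact: (eqmx_trans e1 (eqmx_sym e2)).
  by rewrite circle_point_polar => /(eqmx_rowP nl).
have on_lineE a (u : C * C) : a != 0 -> on_line l (a *: circle_point u) ->
    circle_point u *m l^T = 0.
  rewrite /on_line -scalemxAl => na /eqP; rewrite scaler_eq0 (negbTE na) /=.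
  exact: eqP.
clear htan; have {}hz := on_lineE _ _ nc hz; have {}hw := on_lineE _ _ nc' hw.
suff [e el] : exists e, l = e *: chord z w.
  by exists e => //; apply: contraNneq nl => e0; rewrite el e0 scale0r.
move: hz hw; rewrite [l]row3_eta.
move: (l 0 0) (l 0 1) (l 0 (inord 2)) => a b d.
rewrite !dot_row3 /chord => /scalar11_eq0 hz /scalar11_eq0 hw.
move: sqr_iC iC_neq0 two_neq0 hz hw; set i := 'i%C => ii ni n2.
case: z w nz nw neq => [s r] [s' r'] [/= ->|[-> ->]] [/= ->|[-> ->]];
  rewrite /same_param /= !(mulr1, mul1r, mulr0, mul0r) => neq hz hw.
- have nss : s - s' != 0 by rewrite subr_eq0; apply/eqP.
  have h1 : (a - i * b) * (s + s') + 2 * d = 0.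
    by apply: (mulfI nss); apply: (eq_lincomb2 1 (-1) hz hw); ring.
  have h2 : a + i * b = (a - i * b) * (s * s').
    by apply: (eq_lincomb2 1 (- s) hz h1); ring.
  exists ((a - i * b) / 2); rewrite scale_row3; congr row3; apply: (mulfI n2).
  + by apply: (eq_lincomb1 1 h2); field.
  + apply: (mulfI ni).
    by apply: (eq_lincomb2 1 (- (a - i * b) * (1 - s * s')) h2 ii); field.
  + by apply: (eq_lincomb1 1 h1); field.
- have h1 : a = i * b by apply: (eq_lincomb1 1 hw); ring.
  have h2 : a = - d * s.
    by apply: (mulfI n2); apply: (eq_lincomb2 1 (1 - s ^+ 2) hz h1); ring.
  exists (- d); rewrite scale_row3; congr row3.
  + by rewrite h2; ring.
  + apply: (mulfI ni).
    by apply: (eq_lincomb2 (-1) 1 h1 h2); ring: ii.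
  + by ring.
- have h1 : a = i * b by apply: (eq_lincomb1 1 hz); ring.
  have h2 : a = - d * s'.
    by apply: (mulfI n2); apply: (eq_lincomb2 1 (1 - s' ^+ 2) hw h1); ring.
  exists (- d); rewrite scale_row3; congr row3.
  + by rewrite h2; ring.
  + apply: (mulfI ni).
    by apply: (eq_lincomb2 (-1) 1 h1 h2); ring: ii.
  + by ring.
- by [].
Qed.

Lemma chord_neq0 (a b : C) : chord (a, 1) (b, 1) != 0.
Proof.
apply/eqP => /row3_eq0 /= -[]; rewrite !mulr1 => e1 /eqP.
rewrite mulf_eq0 (negbTE iC_neq0) /= => /eqP e2 _.
by case/eqP: two_neq0; apply: (eq_lincomb2 1 1 e1 e2); ring.
Qed.

Lemma circle_point_neq0 (a : C) : circle_point (a, 1) != 0.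
Proof.
apply/eqP => e; have := circle_point_polar (a, 1); rewrite e mul0mx.
by move=> /esym/eqP; apply/negP; exact: chord_neq0.
Qed.

Lemma circle_point_inj (a b : C) :
  (circle_point (a, 1) == circle_point (b, 1))%MS -> a = b.
Proof.
move=> /(eqmx_rowP (circle_point_neq0 a))[e ne].
rewrite /circle_point scale_row3 => /row3_inj /= [].
rewrite !(expr1n, mulr1) => h1 h2 h3.
have {}h2 : a ^+ 2 - 1 = e * (b ^+ 2 - 1).
  by apply: (mulfI iC_neq0); apply: (eq_lincomb1 (-1) h2); ring.
have e1 : e = 1.
  by apply: (mulfI two_neq0); apply: (eq_lincomb2 (-1) 1 h1 h2); ring.
by apply: (mulfI two_neq0); rewrite h3 e1; ring.
Qed.

End CircleParametrization.

(** * Poncelet triangles *)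

Section Triangles.
Context {R : realType}.
Local Notation C := R[i].
Local Notation K := (complexify (unit_circle_mx R)).
Context (A : 'M[C]_3) (m p1 p2 q1 q2 k : C).
Local Notation D := (focal_dual p1 p2 q1 q2 k).
Local Notation p := (p1 + 'i%C * p2).
Local Notation p' := (p1 - 'i%C * p2).
Local Notation q := (q1 + 'i%C * q2).
Local Notation q' := (q1 - 'i%C * q2).
Context (nm : m != 0) (sA : A^T = A) (AD : A *m D = m%:M).

Let sD : D^T = D. Proof. exact: sym3_tr. Qed.

Lemma tangent_chord z w c : c != 0 -> chord z w != 0 ->
  tangent A (c *: chord z w) <-> side_polar p p' q q' k z w w = 0.
Proof.
move=> nc nch; have nch' : c *: chord z w != 0.
  by rewrite scaler_eq0 negb_or nc.
split=> [/(tangent_dual nm sA sD AD nch')|h].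
  rewrite -scalemxAl linearZ /= -scalemxAr -scalemxAl chord_dual => /eqP.
  rewrite !scaler_eq0 (negbTE nc) /= => /eqP/scalar11_eq0/eqP.
  by rewrite mulf_eq0 (negbTE two_neq0) => /eqP.
apply/(tangent_dual nm sA sD AD nch').
rewrite -scalemxAl linearZ /= -scalemxAr -scalemxAl chord_dual h mulr0.
by rewrite raddf0 !scaler0.
Qed.

(** Each vertex yields a Vieta relation for its two neighbours, so the three parameters form a
    closed triple. *)
Lemma poncelet_triangle_invariant (v l : 'I_3 -> 'rV[C]_3) :
  poncelet_triangle K A v l -> ~ trivial_polygon K A v l ->
  k = (1 - p * p') * (1 - q * q').
Proof.
move=> tri ntriv.
have S3 (i : 'I_3) : ordS (ordS (ordS i)) = i.
  by apply/val_inj; case: i => -[|[|[|//]]].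
have hv i : exists zc : (C * C) * C,
    [/\ normal_param zc.1, zc.2 != 0 & v i = zc.2 *: circle_point zc.1].
  have [nv _ [[ov _] _ _] _] := tri i.
  by have [z [nz [c nc e]]] := circle_pointP nv ov; exists (z, c).
have [zc {}hv] := choice hv; pose z i := (zc i).1.
have nz i : normal_param (z i) by case: (hv i).
have hl i : exists2 e, e != 0 & l i = e *: chord (z i) (z (ordS i)).
  have [_ nl int _] := tri i; have [n1 c1 e1] := hv i.
  have [n2 c2 e2] := hv (ordS i); rewrite e1 e2 in int.
  exact: intersections_chord nl c1 c2 n1 n2 int.
have eqv i j : z i = z j -> (v i == v j)%MS.
  move=> eij; have [_ c1 ->] := hv i; have [_ c2 ->] := hv j.
  rewrite -/(z i) -/(z j) eij; apply/eqmxP.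
  exact: eqmx_trans (eqmx_scale _ c1) (eqmx_sym (eqmx_scale _ c2)).
have eql i j : chord (z i) (z (ordS i)) = chord (z j) (z (ordS j)) ->
    (l i == l j)%MS.
  move=> eij; have [e c1 ->] := hl i; have [e' c2 ->] := hl j; rewrite eij.
  apply/eqmxP.
  exact: eqmx_trans (eqmx_scale _ c1) (eqmx_sym (eqmx_scale _ c2)).
have hvieta i : vieta p p' q q' k (z (ordS i)) (z i) (z (ordS (ordS i))).
  have [_ nl _ [[t1 _] [t2 _] tt]] := tri i.
  have [_ nl' _ _] := tri (ordS i).
  have [e ne el] := hl i; have [e' ne' el'] := hl (ordS i).
  have nch : chord (z (ordS i)) (z i) != 0.
    by apply: contraNneq nl => ch0; rewrite el chordC ch0 scaler0.
  have nch' : chord (z (ordS i)) (z (ordS (ordS i))) != 0.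
    by apply: contraNneq nl' => ch0; rewrite el' ch0 scaler0.
  have [same|neq] := pselect (same_param (z i) (z (ordS (ordS i)))); last first.
    apply: side_vieta => //; first exact: two_neq0.
      by apply/(tangent_chord ne nch); rewrite -chordC -el.
    by apply/(tangent_chord ne' nch'); rewrite -el'.
  have ez := same_param_normal (nz _) (nz _) same.
  apply: side_vieta_double; rewrite ?two_neq0 //; try exact: normal_param_nonzero.
  move=> w.
  (* The two neighbours coincide, hence so do the two sides, and the multiplicity clause makes this
     line touch the conic at the middle vertex. That vertex is then the pole of the side, so each
     chord through it pairs to 0 with the side. *)
  have /tt tan : (l i == l (ordS i))%MS by apply: eql; rewrite -ez chordC.
  have [c nc lD] := tangent_at_dual nm AD nl tan.
  have : chord (z (ordS i)) w *m D *m (l i)^T = 0.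
    have -> : chord (z (ordS i)) w *m D *m (l i)^T =
        chord (z (ordS i)) w *m (l i *m D)^T by rewrite trmx_mul sD mulmxA.
    rewrite lD.
    have [_ _ ->] := hv (ordS i).
    by rewrite !linearZ /= chord_circle_point !scaler0.
  rewrite el linearZ /= chordC -scalemxAr [chord (z i) _]chordC chordC chord_dual.
  move/eqP; rewrite scaler_eq0 (negbTE ne) /= => /eqP/scalar11_eq0/eqP.
  by rewrite mulf_eq0 (negbTE two_neq0) => /eqP.
apply: (@closed_triple_invariant _ p p' q q' k (z 0) (z (ordS 0)) (z (ordS (ordS 0)))).
- exact: nz.
- exact: nz.
- exact: nz.
(* If all parameters agree, the multiplicity clauses make the common side tangent to both conics at
   the common vertex: the polygon is trivial. *)
- move=> [s1 s2]; apply: ntriv.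
  have e1 := same_param_normal (nz _) (nz _) s1.
  have e2 := same_param_normal (nz _) (nz _) s2.
  have ez i : z i = z 0.
    have : i = 0 \/ i = ordS 0 \/ i = ordS (ordS 0).
      by case: i => -[|[|[|//]]] lt3; [left|right; left|right; right]; apply/val_inj.
    by case=> [->|[->|->]] //; rewrite -?e2 -?e1.
  have ech i : chord (z i) (z (ordS i)) = chord (z 0) (z 0) by rewrite !ez.
  exists (v (ordS 0)), (l 0); split.
  + have [_ _ [[_ _] [o _] tt] _] := tri 0; split=> //.
    have /tt[_ el] : (v 0 == v (ordS 0))%MS by apply: eqv; rewrite !ez.
    apply/eqmxP; apply: eqmx_trans (eqmxP el) _; apply: eqmxMr.
    by apply/eqmxP; apply: eqv; rewrite !ez.
  + by have [_ _ _ [_ _ tt]] := tri 0; apply: tt; apply: eql; rewrite !ech.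
  + by move=> i; split; [apply: eqv; rewrite !ez|apply: eql; rewrite !ech].
- have h1 := hvieta 0; have h2 := hvieta (ordS 0).
  have h3 := hvieta (ordS (ordS 0)); rewrite !S3 in h2 h3.
  have vC x y u : vieta p p' q q' k x y u -> vieta p p' q q' k x u y.
    rewrite /vieta => -[h h' h'']; split.
    - by apply: (eq_lincomb1 1 h); ring.
    - by apply: (eq_lincomb1 1 h'); ring.
    - by apply: (eq_lincomb1 1 h''); ring.
  by split; apply: vC.
Qed.

(** For distinct parameters consecutive vertices differ and so do consecutive sides, hence both
    multiplicity clauses hold vacuously. *)
Lemma poncelet_triangle_chords (a b c : C) : a != b -> b != c -> c != a ->
  side_polar p p' q q' k (a, 1) (b, 1) (b, 1) = 0 ->
  side_polar p p' q q' k (b, 1) (c, 1) (c, 1) = 0 ->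
  side_polar p p' q q' k (a, 1) (c, 1) (c, 1) = 0 ->
  exists v l, poncelet_triangle K A v l /\ ~ trivial_polygon K A v l.
Proof.
move=> nab nbc nca hab hbc hac.
pose x (i : 'I_3) : C := [:: a; b; c]`_i.
have inj (i j : 'I_3) : i != j -> x i != x j.
  by case: i j => -[|[|[|//]]] ? [] [|[|[|//]]] ? //= _; rewrite /x /= 1?eq_sym // eq_sym.
pose v i := circle_point (x i, 1).
pose l (i : 'I_3) := chord (x i, 1) (x (ordS i), 1).
have vneq i j : i != j -> ~ (v i == v j)%MS.
  by move=> /inj nij /circle_point_inj/eqP; apply/negP.
have lneq i : ~ (l i == l (ordS i))%MS.
  have nii : i != ordS (ordS i) by case: i => -[|[|[|//]]].
  move=> /(eqmx_rowP (chord_neq0 _ _))[e ne].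
  rewrite /l /chord scale_row3 => /row3_inj /= []; rewrite !mulr1 => h1 h2 h3.
  have {}h2 : 1 - x i * x (ordS i) = e * (1 - x (ordS i) * x (ordS (ordS i))).
    by apply: (mulfI iC_neq0); rewrite h2; ring.
  have e1 : e = 1.
    by apply: (mulfI two_neq0); apply: (eq_lincomb2 (-1) (-1) h1 h2); ring.
  by case/eqP: (inj _ _ nii); apply: (eq_lincomb1 (-1) h3); rewrite e1; ring.
have tan i : tangent A (l i).
  rewrite -[l i]scale1r; apply/tangent_chord; rewrite ?oner_neq0 ?chord_neq0 //.
  case: i => -[|[|[|//]]] ? //=.
  (* The last side runs from [c] back to [a]; the tangency condition is symmetric in the two end
     parameters. *)
  rewrite -[RHS]hac /x /= /side_polar /side_lead /side_mid /side_const /=; ring.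
have on_l (u w : C * C) : on_line (chord u w) (circle_point u).
  by rewrite /on_line -[LHS]trmxK trmx_mul trmxK chord_circle_point trmx0.
have Sneq (i : 'I_3) : i != ordS i by case: i => -[|[|[|//]]].
exists v, l; split.
  move=> i; split; first exact: circle_point_neq0; first exact: chord_neq0.
    split; [split|split|].
    - exact: circle_point_on_circle.
    - exact: on_l.
    - exact: circle_point_on_circle.
    - by rewrite /l chordC; exact: on_l.
    - by move/(vneq _ _ (Sneq i)).
  split; [split|split|].
  - exact: tan.
  - by rewrite /l chordC; exact: on_l.
  - exact: tan.
  - exact: on_l.
  - by move/lneq.
move=> [y [t [_ _ h]]]; apply: (vneq _ _ (Sneq 0)).
have [/eqmxP h0 _] := h 0; have [/eqmxP h1 _] := h (ordS 0).
by apply/eqmxP; exact: eqmx_trans h0 (eqmx_sym h1).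
Qed.

End Triangles.

(** * Equations of conics with given foci *)

Section FocalForm.
Context {R : rcfType}.
Implicit Types (a b c d e f p q t x y : R).

Definition quad a b c d e f x y :=
  a * x ^+ 2 + 2 * b * (x * y) + d * y ^+ 2 + 2 * c * x + 2 * e * y + f.

Lemma quad_frame_eq0 a b c d e f u1 u2 m1 m2 :
  u1 ^+ 2 + u2 ^+ 2 = 1 ->
  (forall X Y : R, quad a b c d e f (m1 + X * u1 - Y * u2) (m2 + X * u2 + Y * u1) = 0) ->
  [/\ a = 0, b = 0, c = 0, d = 0 & e = 0 /\ f = 0].
Proof.
move=> hu h.
have h0 x y : quad a b c d e f x y = 0.
  rewrite -(h ((x - m1) * u1 + (y - m2) * u2) ((y - m2) * u1 - (x - m1) * u2)).
  congr quad.
    transitivity (m1 + (x - m1) * (u1 ^+ 2 + u2 ^+ 2)); last by ring.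
    by rewrite hu; ring.
  transitivity (m2 + (y - m2) * (u1 ^+ 2 + u2 ^+ 2)); last by ring.
  by rewrite hu; ring.
move: (h0 0 0) (h0 1 0) (h0 (-1) 0) (h0 0 1) (h0 0 (-1)) (h0 1 1).
rewrite /quad => *; by do ?split; lra.
Qed.

(** Vanishing at the centre removes the constant term in the frame of the axes. Points of the curve
    with rational coordinates then kill the other five coefficients; [s] distinguishes ellipse from
    hyperbola. *)
Lemma quad_five_points a b c d e f u1 u2 m1 m2 (X0 Y0 s : R) :
  u1 ^+ 2 + u2 ^+ 2 = 1 -> X0 != 0 -> Y0 != 0 -> s = 1 \/ s = -1 ->
  quad a b c d e f m1 m2 = 0 ->
  (forall X Y : R, X ^+ 2 + s * Y ^+ 2 = 1 ->
    quad a b c d e f (m1 + X0 * X * u1 - Y0 * Y * u2)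
      (m2 + X0 * X * u2 + Y0 * Y * u1) = 0) ->
  [/\ a = 0, b = 0, c = 0, d = 0 & e = 0 /\ f = 0].
Proof.
move=> hu nX nY hs hm h.
(* Coefficients in the orthonormal frame u = (u1, u2), n = (-u2, u1) centred at m: the second-order
   part first, then half the gradient at m. *)
pose guu := a * u1 ^+ 2 + 2 * b * (u1 * u2) + d * u2 ^+ 2.
pose gun := b * (u1 ^+ 2 - u2 ^+ 2) + (d - a) * (u1 * u2).
pose gnn := a * u2 ^+ 2 - 2 * b * (u1 * u2) + d * u1 ^+ 2.
pose gum := u1 * (a * m1 + b * m2 + c) + u2 * (b * m1 + d * m2 + e).
pose gnm := u1 * (b * m1 + d * m2 + e) - u2 * (a * m1 + b * m2 + c).
have exp X Y : quad a b c d e f (m1 + X * u1 - Y * u2) (m2 + X * u2 + Y * u1) =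
    X ^+ 2 * guu + 2 * (X * Y) * gun + Y ^+ 2 * gnn + 2 * X * gum + 2 * Y * gnm.
  by rewrite -[LHS]subr0 -hm /quad /guu /gun /gnn /gum /gnm; ring.
have {}h X Y : X ^+ 2 + s * Y ^+ 2 = 1 ->
    X ^+ 2 * (X0 ^+ 2 * guu) + X * Y * (2 * (X0 * Y0) * gun)
    + Y ^+ 2 * (Y0 ^+ 2 * gnn) + X * (2 * X0 * gum) + Y * (2 * Y0 * gnm) = 0.
  by move=> /h; rewrite exp => e0; apply: (eq_lincomb1 1 e0); ring.
have : [/\ X0 ^+ 2 * guu = 0, 2 * (X0 * Y0) * gun = 0, Y0 ^+ 2 * gnn = 0,
    2 * X0 * gum = 0 & 2 * Y0 * gnm = 0].
  move: h; move: (X0 ^+ 2 * guu) (2 * (X0 * Y0) * gun) (Y0 ^+ 2 * gnn)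
    (2 * X0 * gum) (2 * Y0 * gnm) => g1 g2 g3 g4 g5 h.
  have h1 : g1 + g4 = 0 by have := h 1 0; move=> h1; rewrite -[RHS]h1; ring.
  have h2 : g1 - g4 = 0 by have := h (-1) 0; move=> h2; rewrite -[RHS]h2; ring.
  case: hs => es; rewrite es in h.
    have h3 : g3 + g5 = 0 by have := h 0 1; move=> h3; rewrite -[RHS]h3; ring.
    have h4 : g3 - g5 = 0 by have := h 0 (-1); move=> h4; rewrite -[RHS]h4; ring.
    (* A rational point of the unit circle off the axes; the hyperbola below uses (5/4, 3/4) and two
       of its reflections. *)
    have := h (3 / 5) (4 / 5); have -> : (3 / 5) ^+ 2 + 1 * (4 / 5) ^+ 2 = 1 :> R.
      by field.
    by move=> /(_ erefl) h5; split; lra.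
  have e1 : (5 / 4) ^+ 2 - 1 * (3 / 4) ^+ 2 = 1 :> R by field.
  have h3 := h (5 / 4) (3 / 4); have h4 := h (5 / 4) (- (3 / 4)).
  have h5 := h (- (5 / 4)) (3 / 4).
  rewrite !sqrrN !mulN1r in h3 h4 h5; rewrite mul1r in e1.
  have {}h3 := h3 e1; have {}h4 := h4 e1; have {}h5 := h5 e1.
  by split; lra.
move=> [g1 g2 g3 g4 g5].
have z2 (r : R) (g : R) : r != 0 -> r * g = 0 -> g = 0.
  by move=> nr /eqP; rewrite mulf_eq0 (negbTE nr) => /eqP.
have n2 : 2 != 0 :> R by rewrite pnatr_eq0.
apply: (quad_frame_eq0 (m1 := m1) (m2 := m2) hu) => X Y; rewrite exp.
rewrite (z2 _ _ _ g1) ?expf_neq0 // (z2 _ _ _ g2) ?mulf_neq0 //.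
rewrite (z2 _ _ _ g3) ?expf_neq0 // (z2 _ _ _ g4) ?mulf_neq0 //.
by rewrite (z2 _ _ _ g5) ?mulf_neq0 // !mulr0 !addr0.
Qed.

Definition sqdist p1 p2 q1 q2 := (p1 - q1) ^+ 2 + (p2 - q2) ^+ 2.

(* Rationalisation of sqrt U +- sqrt V = +- sqrt t, where U and V are the
   squared distances to the foci; it covers ellipses and hyperbolas at once. *)
Definition focal_form p1 p2 q1 q2 t x y :=
  (sqdist x y p1 p2 - sqdist x y q1 q2) ^+ 2
  - 2 * t * (sqdist x y p1 p2 + sqdist x y q1 q2) + t ^+ 2.

(** The quadratic terms of the squared distances cancel in their difference, which is the affine
    form n1 x + n2 y + n3. Hence [focal_form] is quadratic, and this is its matrix. *)
Definition focal_mx p1 p2 q1 q2 t : 'M[R]_3 :=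
  let n1 := - 2 * (p1 - q1) in
  let n2 := - 2 * (p2 - q2) in
  let n3 := p1 ^+ 2 + p2 ^+ 2 - (q1 ^+ 2 + q2 ^+ 2) in
  sym3 (n1 ^+ 2 - 4 * t) (n1 * n2) (n1 * n3 + 2 * t * (p1 + q1))
    (n2 ^+ 2 - 4 * t) (n2 * n3 + 2 * t * (p2 + q2))
    (n3 ^+ 2 - 2 * t * (p1 ^+ 2 + p2 ^+ 2 + (q1 ^+ 2 + q2 ^+ 2)) + t ^+ 2).

Lemma focal_mx_dual p1 p2 q1 q2 t :
  focal_mx p1 p2 q1 q2 t *m focal_dual p1 p2 q1 q2 (t - sqdist p1 p2 q1 q2)
  = (4 * t * (t - sqdist p1 p2 q1 q2))%:M.
Proof.
apply/matrixP; case; case=> [|[|[|//]]] lti; case; case=> [|[|[|//]]] ltj;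
  rewrite !mxE !big_ord_recl big_ord0 !mxE /= /sqdist ?mulr1n ?mulr0n; ring.
Qed.

Lemma sqdist_ge0 p1 p2 q1 q2 : 0 <= sqdist p1 p2 q1 q2.
Proof. by rewrite addr_ge0 ?sqr_ge0. Qed.

(** The real curve has enough points to determine its equation up to scale: a multiple of the focal
    equation is subtracted so that the difference also vanishes at the centre. *)
Lemma quad_focal_unique a b c d e f p1 p2 q1 q2 t :
  0 < t -> t != sqdist p1 p2 q1 q2 ->
  (forall x y, focal_form p1 p2 q1 q2 t x y = 0 -> quad a b c d e f x y = 0) ->
  exists r, sym3 a b c d e f = r *: focal_mx p1 p2 q1 q2 t.
Proof.
move=> t0 nt h; set W := sqdist p1 p2 q1 q2 in nt *.
pose m1 := (p1 + q1) / 2; pose m2 := (p2 + q2) / 2.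
(* Unit vector along the focal axis; for a circle any direction serves. *)
have [u1 [u2 [hu [e1 e2]]]] : exists u1 u2, u1 ^+ 2 + u2 ^+ 2 = 1 /\
    (p1 - q1 = Num.sqrt W * u1 /\ p2 - q2 = Num.sqrt W * u2).
  have [W0|nW] := eqVneq W 0.
    exists 1, 0; rewrite W0 sqrtr0 !mul0r; split; first by ring.
    move: W0; rewrite /W /sqdist => /eqP.
    by rewrite paddr_eq0 ?sqr_ge0 // !sqrf_eq0 => /andP[/eqP -> /eqP ->].
  have sW : Num.sqrt W != 0.
    by rewrite gt_eqF // sqrtr_gt0 lt_def nW sqdist_ge0.
  exists ((p1 - q1) / Num.sqrt W), ((p2 - q2) / Num.sqrt W); split.
    by rewrite !expr_div_n sqr_sqrtr ?sqdist_ge0 // -mulrDl divff.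
  by rewrite !(mulrC (Num.sqrt W)) !divfK.
have sW2 : Num.sqrt W ^+ 2 = W by rewrite sqr_sqrtr // sqdist_ge0.
pose k := t - W.
have nk : k != 0 by rewrite subr_eq0.
have [s [hs k0]] : exists s : R, (s = 1 \/ s = -1) /\ 0 < s * k.
  have [kp|kn] := ltP 0 k; first by exists 1; rewrite mul1r; split; [left|].
  by exists (-1); rewrite mulN1r oppr_gt0 lt_neqAle nk; split; [right|].
(* The semi-axes, with [s] the sign of [k]. *)
pose X0 := Num.sqrt t / 2; pose Y0 := Num.sqrt (s * k) / 2.
have nX0 : X0 != 0 by rewrite gt_eqF // divr_gt0 ?sqrtr_gt0.
have nY0 : Y0 != 0 by rewrite gt_eqF // divr_gt0 ?sqrtr_gt0.
have X02 : X0 ^+ 2 = t / 4.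
  by rewrite expr_div_n sqr_sqrtr ?ltW // expr2 -natrM.
have Y02 : Y0 ^+ 2 = s * k / 4.
  by rewrite expr_div_n sqr_sqrtr ?ltW // expr2 -natrM.
have frame X Y : focal_form p1 p2 q1 q2 t (m1 + X * u1 - Y * u2) (m2 + X * u2 + Y * u1)
    = - 4 * k * X ^+ 2 - 4 * t * Y ^+ 2 + t * k.
  have ep1 : p1 = m1 + Num.sqrt W * u1 / 2 by rewrite -e1 /m1; field.
  have ep2 : p2 = m2 + Num.sqrt W * u2 / 2 by rewrite -e2 /m2; field.
  have eq1 : q1 = m1 - Num.sqrt W * u1 / 2 by rewrite -e1 /m1; field.
  have eq2 : q2 = m2 - Num.sqrt W * u2 / 2 by rewrite -e2 /m2; field.
  pose g := Num.sqrt W.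
  have s1 : sqdist (m1 + X * u1 - Y * u2) (m2 + X * u2 + Y * u1) p1 p2 =
      (X - g / 2) ^+ 2 + Y ^+ 2.
    rewrite ep1 ep2 /sqdist -/g; transitivity
     (((X - g / 2) ^+ 2 + Y ^+ 2) * (u1 ^+ 2 + u2 ^+ 2)); first by ring.
    by rewrite hu mulr1.
  have s2 : sqdist (m1 + X * u1 - Y * u2) (m2 + X * u2 + Y * u1) q1 q2 =
      (X + g / 2) ^+ 2 + Y ^+ 2.
    rewrite eq1 eq2 /sqdist -/g; transitivity
     (((X + g / 2) ^+ 2 + Y ^+ 2) * (u1 ^+ 2 + u2 ^+ 2)); first by ring.
    by rewrite hu mulr1.
  by rewrite /focal_form s1 s2 /k -sW2 -/g; field.
have ntk : t * k != 0 by rewrite mulf_neq0 // gt_eqF.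
(* At the centre the focal form takes the value t k. *)
pose r := quad a b c d e f m1 m2 / (t * k).
exists r.
have fq x y (F := focal_mx p1 p2 q1 q2 t) : focal_form p1 p2 q1 q2 t x y =
    quad (F 0 0) (F 0 1) (F 0 (inord 2)) (F 1 1) (F 1 (inord 2))
      (F (inord 2) (inord 2)) x y.
  by rewrite /focal_form /quad /sqdist !mxE /= !inordK //=; ring.
have sF : (focal_mx p1 p2 q1 q2 t)^T = focal_mx p1 p2 q1 q2 t by exact: sym3_tr.
move: sF fq; set F := focal_mx _ _ _ _ _ => sF fq.
have := @quad_five_points (a - r * F 0 0) (b - r * F 0 1) (c - r * F 0 (inord 2))
  (d - r * F 1 1) (e - r * F 1 (inord 2)) (f - r * F (inord 2) (inord 2))
  u1 u2 m1 m2 X0 Y0 s hu nX0 nY0 hs.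
have qE x y : quad (a - r * F 0 0) (b - r * F 0 1) (c - r * F 0 (inord 2))
    (d - r * F 1 1) (e - r * F 1 (inord 2)) (f - r * F (inord 2) (inord 2)) x y
    = quad a b c d e f x y - r * focal_form p1 p2 q1 q2 t x y.
  by rewrite fq /quad; ring.
case.
- rewrite qE; have := frame 0 0; rewrite !mul0r !subr0 !addr0 => ->.
  by rewrite expr0n /= !mulr0 subr0 add0r /r divfK // subrr.
- move=> X Y hXY.
  have f0 : focal_form p1 p2 q1 q2 t (m1 + X0 * X * u1 - Y0 * Y * u2)
      (m2 + X0 * X * u2 + Y0 * Y * u1) = 0.
    rewrite frame [(X0 * X) ^+ 2]exprMn [(Y0 * Y) ^+ 2]exprMn X02 Y02.
    have -> : t * k = t * k * (X ^+ 2 + s * Y ^+ 2) by rewrite hXY mulr1.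
    by field.
  by rewrite qE f0 mulr0 subr0; apply: h.
move=> /subr0_eq ea /subr0_eq eb /subr0_eq ec /subr0_eq ed [/subr0_eq ee /subr0_eq ef].
rewrite [F]sym3_eta //; rewrite ea eb ec ed ee ef.
by apply/matrixP; case; case=> [|[|[|//]]] lti; case; case=> [|[|[|//]]] ltj;
  rewrite !mxE.
Qed.

End FocalForm.

(** * Ellipses and hyperbolas as one family of real point sets, with their matrices *)

Section FocalConic.
Context {R : realType}.
Local Notation C := R[i].
Local Notation Re := complex.Re.
Local Notation Im := complex.Im.
Implicit Types (p q w z : C) (t d : R).

Definition sqn z : R := Re z ^+ 2 + Im z ^+ 2.

Definition focal_conic p q t : set C :=
  [set w | focal_form (Re p) (Im p) (Re q) (Im q) t (Re w) (Im w) = 0].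

Definition focal_cmx p q t : 'M[R]_3 := focal_mx (Re p) (Im p) (Re q) (Im q) t.

Lemma normcE_sqn z : `|z| = (Num.sqrt (sqn z))%:C%C.
Proof. exact: normc_def. Qed.

Lemma sqn_ge0 z : 0 <= sqn z.
Proof. by rewrite addr_ge0 ?sqr_ge0. Qed.

Lemma sqdistE z w : sqdist (Re z) (Im z) (Re w) (Im w) = sqn (z - w).
Proof. by case: z w => [? ?] [? ?]. Qed.

Lemma sqnM z w : sqn (z * w) = sqn z * sqn w.
Proof. by case: z w => [a b] [c d]; rewrite /sqn /=; ring. Qed.

Lemma triangle_sqn z w : Num.sqrt (sqn (z + w)) <= Num.sqrt (sqn z) + Num.sqrt (sqn w).
Proof. by rewrite -lecR rmorphD /= -!normcE_sqn ler_normD. Qed.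

Lemma sqnN z : sqn (- z) = sqn z.
Proof. by case: z => a b; rewrite /sqn /= !sqrrN. Qed.

(** The form factors into the ellipse condition, that the distances have sum [d], and the hyperbola
    condition, that their difference is [d] up to sign. *)
Lemma focal_formE p q d w :
  let u := Num.sqrt (sqn (w - p)) in let v := Num.sqrt (sqn (w - q)) in
  focal_form (Re p) (Im p) (Re q) (Im q) (d ^+ 2) (Re w) (Im w) =
  (d ^+ 2 - (u + v) ^+ 2) * (d ^+ 2 - (u - v) ^+ 2).
Proof.
move=> u v; rewrite /focal_form !sqdistE.
have -> : sqn (w - p) = u ^+ 2 by rewrite sqr_sqrtr ?sqn_ge0.
have -> : sqn (w - q) = v ^+ 2 by rewrite sqr_sqrtr ?sqn_ge0.
by ring.
Qed.

Lemma focal_distances p q w :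
  let u := Num.sqrt (sqn (w - p)) in let v := Num.sqrt (sqn (w - q)) in
  let g := Num.sqrt (sqn (p - q)) in
  [/\ 0 <= u, 0 <= v, g <= u + v & `|u - v| <= g].
Proof.
move=> u v g; split; rewrite ?sqrtr_ge0 //.
  rewrite /g (_ : p - q = - (w - p) + (w - q)); last by ring.
  by apply: le_trans (triangle_sqn _ _) _; rewrite sqnN.
rewrite ler_norml lerBlDr lerNl opprB lerBlDr; apply/andP; split.
  rewrite /v (_ : w - q = (p - q) + (w - p)); last by ring.
  exact: triangle_sqn.
rewrite /u (_ : w - p = - (p - q) + (w - q)); last by ring.
by apply: le_trans (triangle_sqn _ _) _; rewrite sqnN.
Qed.

Lemma sqr_eq_nonneg (x y : R) : 0 <= x -> 0 <= y -> x ^+ 2 - y ^+ 2 = 0 -> x = y.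
Proof.
move=> x0 y0 /eqP; rewrite subr_eq0 eqrXn2 // => /eqP //.
Qed.

(** The difference of the distances is at most the focal distance, which is less than [d]; so the
    hyperbola factor never vanishes. *)
Lemma ellipse_focal p q d : Num.sqrt (sqn (p - q)) < d ->
  ellipse p q d%:C%C = focal_conic p q (d ^+ 2).
Proof.
move=> gd; rewrite predeqE => w; rewrite /ellipse /focal_conic /= focal_formE.
rewrite !normcE_sqn -rmorphD /=.
have := focal_distances p q w; cbv zeta.
move: (Num.sqrt (sqn (w - p))) (Num.sqrt (sqn (w - q))) => u v [u0 v0 h1 h2].
have g0 : 0 <= Num.sqrt (sqn (p - q)) by rewrite sqrtr_ge0.
split=> [/complexI ->|/eqP]; first by rewrite subrr mul0r.
rewrite mulf_eq0 => /orP[] /eqP h.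
  by congr (_%:C)%C; apply/esym/sqr_eq_nonneg; rewrite // ?addr_ge0 //; lra.
rewrite -[(u - v) ^+ 2]real_normK ?num_real // in h.
have dE : d = `|u - v| by apply: sqr_eq_nonneg => //; lra.
by exfalso; lra.
Qed.

(** The sum of the distances is at least the focal distance, which exceeds [d]; so the ellipse
    factor never vanishes. *)
Lemma hyperbola_focal p q d : 0 < d < Num.sqrt (sqn (p - q)) ->
  hyperbola p q d%:C%C = focal_conic p q (d ^+ 2).
Proof.
move=> /andP[d0 gd]; rewrite predeqE => w; rewrite /hyperbola /focal_conic /= focal_formE.
rewrite !normcE_sqn -rmorphB /=.
have := focal_distances p q w; cbv zeta.
move: (Num.sqrt (sqn (w - p))) (Num.sqrt (sqn (w - q))) => u v [u0 v0 h1 h2].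
rewrite /sqn /= expr0n /= addr0 sqrtr_sqr.
rewrite -[(u - v) ^+ 2]real_normK ?num_real //.
split=> [/complexI ->|/eqP]; first by rewrite subrr mulr0.
rewrite mulf_eq0 => /orP[] /eqP h.
  have dE : d = u + v by apply: sqr_eq_nonneg => //; lra.
  by exfalso; lra.
by congr (_%:C)%C; apply/esym/sqr_eq_nonneg => //; exact: ltW.
Qed.

Lemma conic_with_fociP p q (S : set C) : conic_with_foci p q S ->
  exists t, [/\ 0 < t, t != sqn (p - q) & S = focal_conic p q t].
Proof.
have g0 : 0 <= Num.sqrt (sqn (p - q)) by rewrite sqrtr_ge0.
have gE : sqn (p - q) = Num.sqrt (sqn (p - q)) ^+ 2.
  by rewrite sqr_sqrtr ?sqn_ge0.
case=> [[[d e]]|[[d e]]].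
  rewrite normcE_sqn ltcE /= => /andP[/eqP -> gd] ->.
  have d0 : 0 < d by exact: le_lt_trans gd.
  exists (d ^+ 2); split; first by rewrite exprn_gt0.
    by rewrite gE gt_eqF // ltrXn2r ?nnegrE // ltW.
  exact: ellipse_focal.
rewrite normcE_sqn !ltcE /= => /andP[/andP[/eqP -> d0] /andP[_ gd]] ->.
exists (d ^+ 2); split; first by rewrite exprn_gt0.
  by rewrite gE lt_eqF // ltrXn2r ?nnegrE // ltW.
by apply: hyperbola_focal; rewrite d0.
Qed.

Lemma on_conic_quad a b c d e f w :
  on_conic (complexify (sym3 a b c d e f)) (plane_point w) <->
  quad a b c d e f (Re w) (Im w) = 0.
Proof.
rewrite /on_conic /complexify map_sym3 (_ : plane_point w = row3 (Re w)%:C%C (Im w)%:C%C 1) //.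
rewrite row3_mul_sym3 dot_row3.
set x := (X in X%:M); have -> : x = (quad a b c d e f (Re w) (Im w))%:C%C.
  by rewrite /x /quad; ring.
split=> [/scalar11_eq0/complexI //|->].
by apply/scalar11_eq0.
Qed.

Lemma focal_quad p q t w (F := focal_cmx p q t) :
  focal_form (Re p) (Im p) (Re q) (Im q) t (Re w) (Im w) =
  quad (F 0 0) (F 0 1) (F 0 (inord 2)) (F 1 1) (F 1 (inord 2))
    (F (inord 2) (inord 2)) (Re w) (Im w).
Proof. by rewrite /focal_form /quad /sqdist !mxE /= !inordK //=; ring. Qed.

Lemma focal_cmx_tr p q t : (focal_cmx p q t)^T = focal_cmx p q t.
Proof. exact: sym3_tr. Qed.

Lemma focal_conic_equation p q t : 0 < t -> t != sqn (p - q) ->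
  conic_equation (focal_cmx p q t) (focal_conic p q t).
Proof.
move=> t0 nt; split; first exact: focal_cmx_tr.
  have := focal_mx_dual (Re p) (Im p) (Re q) (Im q) t.
  move=> /(congr1 determinant); rewrite det_mulmx det_scalar => h.
  apply: contraTneq isT => d0; move: h; rewrite -/(focal_cmx p q t) d0 mul0r.
  move=> /esym/eqP; rewrite expf_eq0 /= !mulf_eq0 pnatr_eq0 /= gt_eqF //=.
  by rewrite subr_eq0 sqdistE (negbTE nt).
rewrite predeqE => w; rewrite /focal_conic /= focal_quad.
apply: iff_sym; apply: iff_trans (on_conic_quad _ _ _ _ _ _ _).
by rewrite -sym3_eta ?focal_cmx_tr.
Qed.

(** [poncelet3_inscribed] accepts any real matrix with the right real points; this pins it down up
    to scale, so the complex tangents are the expected ones. *)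
Lemma focal_conic_equation_unique p q t A : 0 < t -> t != sqn (p - q) ->
  conic_equation A (focal_conic p q t) ->
  exists2 r, r != 0 & A = r *: focal_cmx p q t.
Proof.
move=> t0 nt [sA dA eA].
have [r er] : exists r, A = r *: focal_cmx p q t.
  have [||x y h|r er] := @quad_focal_unique _ (A 0 0) (A 0 1) (A 0 (inord 2)) (A 1 1)
      (A 1 (inord 2)) (A (inord 2) (inord 2)) (Re p) (Im p) (Re q) (Im q) t.
  - exact: t0.
  - by rewrite sqdistE.
  - have : (focal_conic p q t) (x +i* y)%C by [].
    by rewrite eA /= {1}[A]sym3_eta // => /on_conic_quad.
  - by exists r; rewrite -er; exact: sym3_eta.
exists r => //; apply: contraNneq dA => r0; rewrite er r0 scale0r det0 //.
Qed.

End FocalConic.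

(** * The forced length of the major axis, and the construction of a Poncelet triangle *)

Section PonceletFocal.
Context {R : realType}.
Local Notation C := R[i].
Local Notation Re := complex.Re.
Local Notation Im := complex.Im.
Implicit Types (p q w z : C) (t d : R).

Lemma conjE p : p^* = (Re p)%:C%C - 'i%C * (Im p)%:C%C.
Proof.
by case: p => a b; apply/eqP; rewrite eq_complex /=; apply/andP; split; apply/eqP; ring.
Qed.

Lemma mulcJ_sqn p : p * p^* = (sqn p)%:C%C.
Proof. by rewrite -normCK -add_Re2_Im2. Qed.

Lemma sqn_conj p : sqn p^* = sqn p.
Proof. by rewrite conjE; case: p => a b; rewrite /sqn /=; ring. Qed.

(** Turns the forced value k = (1 - |p|^2) (1 - |q|^2) into the squared axis length, and also
    compares |p - z| with |1 - p^* z| for a Blaschke factor. *)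
Lemma sqn_blaschke p q :
  sqn (1 - p^* * q) - sqn (p - q) = (1 - sqn p) * (1 - sqn q).
Proof.
by rewrite conjE; case: p q => [a b] [c d]; rewrite /sqn /=; ring.
Qed.

Lemma focal_cmx_dual p q t r :
  complexify (r *: focal_cmx p q t) *m
  focal_dual (Re p)%:C%C (Im p)%:C%C (Re q)%:C%C (Im q)%:C%C
    (t - sqn (p - q))%:C%C =
  ((r * (4 * t * (t - sqn (p - q))))%:C%C)%:M.
Proof.
have -> : focal_dual (Re p)%:C%C (Im p)%:C%C (Re q)%:C%C (Im q)%:C%C
    (t - sqn (p - q))%:C%C =
    complexify (focal_dual (Re p) (Im p) (Re q) (Im q) (t - sqn (p - q))).
  by rewrite /complexify map_sym3; congr sym3; ring.
rewrite /complexify -map_mxM /= -scalemxAl -sqdistE focal_mx_dual.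
by rewrite scale_scalar_mx map_scalar_mx.
Qed.

Lemma complexify_tr (A : 'M[R]_3) : A^T = A -> (complexify A)^T = complexify A.
Proof. by rewrite /complexify map_trmx => ->. Qed.

Lemma focal_scale_neq0 p q t r : 0 < t -> t != sqn (p - q) -> r != 0 ->
  (r * (4 * t * (t - sqn (p - q))))%:C%C != 0 :> C.
Proof.
move=> t0 nt nr; rewrite fmorph_eq0 !mulf_neq0 ?pnatr_eq0 ?subr_eq0 //.
by rewrite gt_eqF.
Qed.

Lemma poncelet_focal_conic p q t : 0 < t -> t != sqn (p - q) ->
  poncelet3_inscribed (focal_conic p q t) -> t = sqn (1 - p^* * q).
Proof.
move=> t0 nt [A eA [v [l [tri ntriv]]]].
have [r nr rA] := focal_conic_equation_unique t0 nt eA.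
have sA : (complexify A)^T = complexify A by case: eA => sA _ _; exact: complexify_tr.
have AD := focal_cmx_dual p q t r; rewrite -rA in AD.
have := poncelet_triangle_invariant (focal_scale_neq0 t0 nt nr) sA AD tri ntriv.
rewrite -!conjE -!complexE !mulcJ_sqn => /esym.
have -> : (1 - (sqn p)%:C%C) * (1 - (sqn q)%:C%C) =
    ((1 - sqn p) * (1 - sqn q))%:C%C :> C by ring.
by move=> /complexI; rewrite -sqn_blaschke => /addIr.
Qed.

Lemma blaschke_ellipse_lt p q : sqn p < 1 -> sqn q < 1 ->
  Num.sqrt (sqn (p - q)) < Num.sqrt (sqn (1 - p^* * q)).
Proof.
move=> p1 q1; have := sqn_blaschke p q.
have k0 : 0 < (1 - sqn p) * (1 - sqn q) by rewrite mulr_gt0 ?subr_gt0.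
have := sqn_ge0 (p - q) => g0 h; rewrite ltr_sqrt; lra.
Qed.

Lemma norm_lt1_sqn z : (`|z| < 1) = (sqn z < 1).
Proof.
rewrite normcE_sqn (_ : 1 = (1 : R)%:C%C) // ltcR -[in LHS]sqrtr1 ltr_sqrt //.
Qed.

(** Writing 1 - p^* q = (1 - p)^* + p^* (1 - q) and using |p| < 1 and q != 1 shows that the
    distances from 1 to the foci have a sum larger than the major axis. *)
Lemma focal_conic_one p q : sqn p < 1 -> sqn q < 1 ->
  ~ focal_conic p q (sqn (1 - p^* * q)) 1.
Proof.
move=> p1 q1; rewrite -[sqn (1 - _)]sqr_sqrtr ?sqn_ge0 //.
rewrite -ellipse_focal ?blaschke_ellipse_lt // /ellipse /= -normcE_sqn => h.
suff : `|1 - p^* * q| < `|1 - p| + `|1 - q| by rewrite h ltxx.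
rewrite (_ : 1 - p^* * q = (1 - p)^* + p^* * (1 - q)); last first.
  by rewrite rmorphB rmorph1 /=; ring.
apply: le_lt_trans (ler_normD _ _) _.
rewrite normrM !norm_conjC ltrD2l gtr_pMl ?norm_lt1_sqn // normr_gt0.
apply: contraTneq q1 => /subr0_eq <-.
by rewrite /sqn /= expr0n expr1n addr0 ltxx.
Qed.

Lemma focal_conic_poncelet p q : sqn p < 1 -> sqn q < 1 ->
  poncelet3_inscribed (focal_conic p q (sqn (1 - p^* * q))).
Proof.
move=> p1 q1; set t := sqn _.
have kE : t - sqn (p - q) = (1 - sqn p) * (1 - sqn q) by exact: sqn_blaschke.
have k0 : 0 < t - sqn (p - q) by rewrite kE mulr_gt0 ?subr_gt0.
have nt : t != sqn (p - q) by rewrite -subr_eq0 gt_eqF.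
have t0 : 0 < t by have := sqn_ge0 (p - q); lra.
exists (focal_cmx p q t); first exact: focal_conic_equation.
have sA : (complexify (focal_cmx p q t))^T = complexify (focal_cmx p q t).
  by apply: complexify_tr; exact: focal_cmx_tr.
have AD := focal_cmx_dual p q t 1; rewrite scale1r in AD.
have nm := focal_scale_neq0 t0 nt (oner_neq0 R).
pose k : C := (t - sqn (p - q))%:C%C.
have kC : k = (1 - p * p^*) * (1 - q * q^*).
  by rewrite !mulcJ_sqn /k kE; ring.
(* The quadratic a w^2 - b w + c at the vertex 1; its roots [x] and [y] below are the two other
   vertices. *)
pose a := side_lead p^* q^* (1, 1); pose b := side_mid p p^* q q^* k (1, 1).
pose c := side_const p q (1, 1).
have neq1 w : sqn w < 1 -> 1 - w != 0.
  move=> w1; apply: contraTneq w1 => /subr0_eq <-.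
  by rewrite /sqn /= expr0n expr1n addr0 ltxx.
have na : a != 0.
  by rewrite /a /side_lead /= !mulr1 mulf_neq0 // neq1 // sqn_conj.
have nc : c != 0.
  by rewrite /c /side_const /= !mulr1 mulf_neq0 // -opprB oppr_eq0 neq1.
(* The discriminant is the focal form at 1: the two tangents from 1 coincide only if 1 lies on the
   conic. *)
have disc : b ^+ 2 - 4 * (a * c) != 0.
  have -> : b ^+ 2 - 4 * (a * c) =
      (focal_form (Re p) (Im p) (Re q) (Im q) t (Re 1) (Im 1))%:C%C.
    have bE : b = (t - sqn (1 - p) - sqn (1 - q))%:C%C.
      rewrite !rmorphB /= -(mulcJ_sqn (1 - p)) -(mulcJ_sqn (1 - q)).
      rewrite !rmorphB /= rmorph1 /b /side_mid /k rmorphB /=.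
      by rewrite -(mulcJ_sqn (p - q)) rmorphB /=; ring.
    have acE : a * c = (sqn (1 - p) * sqn (1 - q))%:C%C.
      rewrite rmorphM /= -!mulcJ_sqn !rmorphB /= rmorph1.
      by rewrite /a /c /side_lead /side_const /=; ring.
    by rewrite bE acE /focal_form !sqdistE; ring.
  by rewrite fmorph_eq0; apply/eqP; exact: focal_conic_one.
(* The value of the quadratic at w = 1; it would vanish if the tangent to the circle at 1 touched
   the conic. It is positive because |1 - w|^2 > 0 gives 1 - |w|^2 < 2 (1 - Re w) for both foci. *)
have tan1 : a - b + c != 0.
  have -> : a - b + c = (2 * (1 - Re p) * (2 * (1 - Re q))
      - (1 - sqn p) * (1 - sqn q))%:C%C.
    have reE w : w + w^* = 2 * (Re w)%:C%C by rewrite conjE {1}[w]complexE; ring.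
    rewrite -kE rmorphB /= -/k.
    transitivity ((2 - (p + p^*)) * (2 - (q + q^*)) - k); last by rewrite !reE; ring.
    by rewrite /a /b /c /side_lead /side_mid /side_const /=; ring.
  have lt w : sqn w < 1 -> 1 - sqn w < 2 * (1 - Re w).
    move=> /neq1; case: (w) => u v; rewrite eq_complex /= negb_and /sqn /= => h.
    have : 0 < (1 - u) ^+ 2 + (0 - v) ^+ 2.
      rewrite lt_def paddr_eq0 ?sqr_ge0 // !sqrf_eq0 negb_and h /=.
      by rewrite addr_ge0 ?sqr_ge0.
    by rewrite sub0r sqrrN sqrrB; lra.
  by rewrite fmorph_eq0 subr_eq0 gt_eqF // ltr_pM ?lt // ltW // subr_gt0.
have n2 := two_neq0 (R := R).
pose e := sqrtc (b ^+ 2 - 4 * (a * c)).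
have e2 : e ^+ 2 = b ^+ 2 - 4 * (a * c) by exact: sqr_sqrtc.
have ne : e != 0 by apply: contra_neq disc => e0; rewrite -e2 e0 expr0n.
pose x := (b + e) / (2 * a); pose y := (b - e) / (2 * a).
have xy : a * (x * y) = c.
  transitivity ((b ^+ 2 - e ^+ 2) / (4 * a)).
    by rewrite /x /y; field; rewrite na.
  by rewrite e2; field; rewrite na.
have xDy : a * (x + y) = b by rewrite /x /y; field; rewrite na.
have root w : a * w ^+ 2 - b * w + c = 0 ->
    side_polar p p^* q q^* k (1, 1) (w, 1) (w, 1) = 0.
  move=> h; rewrite /side_polar -/a -/b -/c /= .
  by apply: (eq_lincomb1 2 h); ring.
have rx : a * x ^+ 2 - b * x + c = 0 by rewrite -xy -xDy; ring.
have ry : a * y ^+ 2 - b * y + c = 0 by rewrite -xy -xDy; ring.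
have neq1' w : a * w ^+ 2 - b * w + c = 0 -> 1 != w.
  by move=> h; apply: contra_neq tan1 => w1; rewrite -[RHS]h -w1; ring.
have nx0 : x != 0 by apply: contra_neq nc => x0; rewrite -xy x0; ring.
have nxy : x != y.
  rewrite -subr_eq0 (_ : x - y = e / a) ?mulf_neq0 ?invr_eq0 //.
  by rewrite /x /y; field; rewrite na.
have cl : side_polar p p^* q q^* k (x, 1) (y, 1) (y, 1) = 0.
  rewrite kC; apply: (poncelet_closure (a := 1)); rewrite ?oner_neq0 //.
  by rewrite -kC.
apply: (poncelet_triangle_chords nm sA AD (a := 1) (b := x) (c := y));
  rewrite -?conjE -?complexE //; first exact: neq1'.
- by rewrite eq_sym; exact: neq1'.
- exact: root.
- exact: root.
Qed.

End PonceletFocal.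

(** * Level sets of the Blaschke product and tangents of the ellipse *)

Section BlaschkeEllipse.
Context {R : realType}.
Local Notation C := R[i].
Local Notation Re := complex.Re.
Local Notation Im := complex.Im.
Implicit Types (p q w z : C) (t d : R).

(** On the unit circle the conjugate of z is 1/z, so the coordinates X, Y, T of the point are z,
    1/z, 1. *)
Lemma plane_point_circle z : sqn z = 1 ->
  plane_point z = (2 * z)^-1 *: circle_point (z, 1).
Proof.
move=> z1; have zz : z * z^* = 1 by rewrite mulcJ_sqn z1.
have nz : z != 0.
  by apply: contraTneq isT => z0; move/eqP: zz; rewrite z0 mul0r eq_sym oner_eq0.
have n2 := two_neq0 (R := R); have n2z : 2 * z != 0 by rewrite mulf_neq0.
have ii := sqr_iC (R := R); have ni := iC_neq0 (R := R).
have h1 : z + z^* = 2 * (Re z)%:C%C by rewrite conjE {1}[z]complexE; ring.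
have h2 : z - z^* = 2 * 'i%C * (Im z)%:C%C by rewrite conjE {1}[z]complexE; ring.
rewrite (_ : plane_point z = row3 (Re z)%:C%C (Im z)%:C%C 1) //.
rewrite scale_row3 /=; congr row3; apply: (mulfI n2z); rewrite mulVKf //.
- by apply: (eq_lincomb2 (- z) 1 h1 zz); ring.
- apply: (mulfI ni).
  by apply: (eq_lincomb2 (- z) (-1) h2 zz); ring: ii.
- by ring.
Qed.

(** Inside the disc all three factors of B have modulus less than 1; outside it, when defined, all
    have modulus greater than 1. *)
Lemma blaschke_norm1 p q z : sqn p < 1 -> sqn q < 1 ->
  `|blaschke p q z| = 1 ->
  [/\ sqn z = 1, 1 - p^* * z != 0 & 1 - q^* * z != 0].
Proof.
move=> p1 q1 h.
(* Division by 0 yields 0, so at a pole the formal value of B is 0, not of modulus 1. *)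
have np : 1 - p^* * z != 0.
  apply/negP => /eqP e; move: h; rewrite /blaschke e invr0 !mulr0 mul0r normr0.
  by move=> /esym/eqP; rewrite oner_eq0.
have nq : 1 - q^* * z != 0.
  apply/negP => /eqP e; move: h; rewrite /blaschke e invr0 !mulr0 normr0.
  by move=> /esym/eqP; rewrite oner_eq0.
split=> //.
have e : sqn z * (sqn (p - z) * sqn (q - z)) =
    sqn (1 - p^* * z) * sqn (1 - q^* * z).
  have b1 : sqn (blaschke p q z) = 1.
    by apply: complexI; rewrite /sqn add_Re2_Im2 h expr1n.
  rewrite -[RHS]mul1r -b1 -!sqnM; congr sqn; rewrite /blaschke.
  by field; rewrite np nq.
have := sqn_blaschke p z; have := sqn_blaschke q z.
have a0 := sqn_ge0 (p - z); have b0 := sqn_ge0 (q - z).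
have a0' := sqn_ge0 (1 - p^* * z); have b0' := sqn_ge0 (1 - q^* * z).
have z0 := sqn_ge0 z.
move: e a0 b0 a0' b0' z0; move: (sqn (p - z)) (sqn (q - z)) (sqn (1 - p^* * z))
  (sqn (1 - q^* * z)) (sqn z) => a b a' b' n e a0 b0 a0' b0' n0 hb ha.
have [lt1|gt1|//] := ltgtP n 1; exfalso.
  have lta : a < a' by rewrite -subr_gt0 ha mulr_gt0 ?subr_gt0.
  have ltb : b < b' by rewrite -subr_gt0 hb mulr_gt0 ?subr_gt0.
  have := ltr_pM a0 b0 lta ltb; rewrite -e ltNge => /negP; apply.
  by rewrite ler_piMl ?mulr_ge0 // ltW.
have lta : a' < a by rewrite -subr_lt0 ha pmulr_rlt0 ?subr_gt0 // subr_lt0.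
have ltb : b' < b by rewrite -subr_lt0 hb pmulr_rlt0 ?subr_gt0 // subr_lt0.
have := ltr_pM a0' b0' lta ltb; rewrite -e ltNge => /negP; apply.
by rewrite ler_peMl ?mulr_ge0 // ltW.
Qed.

(** Both points lie on the circle, so the line is a chord; its ends share the Blaschke value L, and
    [blaschke_side] gives the tangency. *)
Lemma blaschke_ellipse_tangent p q (t := sqn (1 - p^* * q)) L z1 z2 l :
  sqn p < 1 -> sqn q < 1 -> `|L| = 1 ->
  blaschke p q z1 = L -> blaschke p q z2 = L -> z1 != z2 -> l != 0 ->
  on_line l (plane_point z1) -> on_line l (plane_point z2) ->
  tangent (complexify (focal_cmx p q t)) l.
Proof.
move=> p1 q1 L1 b1 b2 n12 nl o1 o2.
have [s1 np1 nq1] : [/\ sqn z1 = 1, 1 - p^* * z1 != 0 & 1 - q^* * z1 != 0].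
  by apply: blaschke_norm1; rewrite ?b1.
have [s2 np2 nq2] : [/\ sqn z2 = 1, 1 - p^* * z2 != 0 & 1 - q^* * z2 != 0].
  by apply: blaschke_norm1; rewrite ?b2.
have nz z : sqn z = 1 -> z != 0.
  move=> h; apply/eqP => z0; move: h; rewrite z0 /sqn /= expr0n addr0 => /esym/eqP.
  by rewrite oner_eq0.
have n2 := two_neq0 (R := R).
have nc z : sqn z = 1 -> (2 * z)^-1 != 0.
  by move=> /nz h; rewrite invr_eq0 mulf_neq0.
have kE : t - sqn (p - q) = (1 - sqn p) * (1 - sqn q) by exact: sqn_blaschke.
have k0 : 0 < t - sqn (p - q) by rewrite kE mulr_gt0 ?subr_gt0.
have nt : t != sqn (p - q) by rewrite -subr_eq0 gt_eqF.
have t0 : 0 < t by have := sqn_ge0 (p - q); lra.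
have sA : (complexify (focal_cmx p q t))^T = complexify (focal_cmx p q t).
  by apply: complexify_tr; exact: focal_cmx_tr.
have AD := focal_cmx_dual p q t 1; rewrite scale1r in AD.
have nm := focal_scale_neq0 t0 nt (oner_neq0 R).
rewrite (plane_point_circle s1) in o1; rewrite (plane_point_circle s2) in o2.
have on z : on_conic (complexify (unit_circle_mx R)) ((2 * z)^-1 *: circle_point (z, 1)).
  rewrite /on_conic linearZ /= -!scalemxAl -scalemxAr.
  by rewrite [_ *m _ *m _]circle_point_on_circle !scaler0.
have norm z : normal_param (z, 1 : C) by left.
have [e ne ->] : exists2 e, e != 0 & l = e *: chord (z1, 1) (z2, 1).
  apply: (intersections_chord nl (nc _ s1) (nc _ s2) (norm _) (norm _)).
  split=> // h; case/eqP: n12; apply: circle_point_inj.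
  apply/eqmxP; apply: eqmx_trans (eqmx_sym (eqmx_scale _ (nc _ s1))) _.
  exact: eqmx_trans (eqmxP h) (eqmx_scale _ (nc _ s2)).
apply/(tangent_chord nm sA AD ne (chord_neq0 _ _)).
rewrite -!conjE -!complexE.
have -> : ((t - sqn (p - q))%:C)%C = (1 - p * p^*) * (1 - q * q^*) :> C.
  by rewrite !mulcJ_sqn kE; ring.
apply: (@blaschke_side _ _ _ _ _ L) => //; try exact: nz.
- by rewrite -b1 /blaschke /side_const /side_lead /= !mulr1; field; rewrite np1 nq1.
- by rewrite -b2 /blaschke /side_const /side_lead /= !mulr1; field; rewrite np2 nq2.
Qed.

End BlaschkeEllipse.

(** * Existence, uniqueness and identification of the inscribed conic *)

Theorem theorem5p7 (R : realType) (p q : R[i]) (hp : `|p| < 1) (hq : `|q| < 1) :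
  (exists! C : set R[i], conic_with_foci p q C /\ poncelet3_inscribed C) /\
  (forall C : set R[i], conic_with_foci p q C -> poncelet3_inscribed C ->
    [/\ ellipse_with_foci p q C,
        blaschke_ellipse p q C &
        C = [set w : R[i] | `|w - p| + `|w - q| = `|1 - p^* * q|]]).
Proof.
have p1 : sqn p < 1 by rewrite -norm_lt1_sqn.
have q1 : sqn q < 1 by rewrite -norm_lt1_sqn.
have kE := sqn_blaschke p q; set t := sqn _ in kE.
have k0 : 0 < t - sqn (p - q) by rewrite kE mulr_gt0 ?subr_gt0.
have nt : t != sqn (p - q) by rewrite -subr_eq0 gt_eqF.
have t0 : 0 < t by have := sqn_ge0 (p - q); lra.
have focE : focal_conic p q t = ellipse p q `|1 - p^* * q|.
  rewrite normcE_sqn ellipse_focal ?blaschke_ellipse_lt //.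
  by rewrite sqr_sqrtr ?sqn_ge0.
have foc : ellipse_with_foci p q (focal_conic p q t).
  exists `|1 - p^* * q| => //.
  by rewrite !normcE_sqn ltcR blaschke_ellipse_lt.
(* The foci and the squared axis length determine the point set, and a Poncelet triangle forces that
   length. *)
have uniq S : conic_with_foci p q S -> poncelet3_inscribed S -> S = focal_conic p q t.
  move=> /conic_with_fociP[t' [t'0 nt' ->]].
  by move=> /(poncelet_focal_conic t'0 nt') ->.
split.
  exists (focal_conic p q t); split.
    by split; [left | exact: focal_conic_poncelet].
  by move=> S [h1 h2]; rewrite (uniq S).
move=> S h1 h2; rewrite (uniq S h1 h2); split=> //.
split=> //; exists (focal_cmx p q t); first exact: focal_conic_equation.
move=> L z1 z2 L1 b1 b2 n12 l nl o1 o2.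
exact: (blaschke_ellipse_tangent p1 q1 L1 b1 b2 n12 nl o1 o2).
Qed.
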